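(* Let $X\in\{I,S^1\}$ and let $a,b,t\in\mathrm{Diff}^1_+(X)$. If $\operatorname{supp} a\cap\operatorname{supp} b=\varnothing$, then the group $\langle a,b,t\rangle$ is not isomorphic to $\mathbb{Z}^2*\mathbb{Z}$.
   Context: $I=[0,1]$ and $S^1=\mathbb{R}/\mathbb{Z}$. $\mathrm{Diff}^1_+(X)$ is the group of orientation preserving $C^1$ diffeomorphisms of $X$. For a homeomorphism $h$ of $X$, $\operatorname{supp} h=\{x\in X: h(x)\ne x\}$ is the open support (no closure is taken). $\langle a,b,t\rangle$ is the subgroup generated by $a,b,t$, and $*$ is free product. *)

(* Defs.v *)
From HB Require Import structures.
From mathcomp Require Import all_boot all_order all_algebra.
From mathcomp Require Import all_classical all_reals all_analysis.

Set Implicit Arguments.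
Unset Strict Implicit.
Unset Printing Implicit Defensive.

Import Order.TTheory GRing.Theory Num.Theory.
Import numFieldNormedType.Exports.

Local Open Scope classical_set_scope.
Local Open Scope ring_scope.
Local Open Scope quotient_scope.

Section Groups.
Local Open Scope group_scope.
Variable G : groupType.

Definition is_subgroup (H : set G) : Prop :=
  [/\ H 1, forall x y, H x -> H y -> H (x * y) & forall x, H x -> H x^-1].

Definition generated (S : set G) : set G := smallest is_subgroup S.

Definition subgroup_isog (H : set G) (K : groupType) : Prop :=
  exists phi : {multiplicative K -> G}, set_bij [set: K] H phi.

End Groups.

Section FreeProduct.
Local Open Scope group_scope.
Variables A B : groupType.

Inductive fp_eq : seq (A + B) -> seq (A + B) -> Prop :=
| fp_refl u : fp_eq u u
| fp_sym u v : fp_eq u v -> fp_eq v u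
| fp_trans u v w : fp_eq u v -> fp_eq v w -> fp_eq u w
| fp_cat u u' v v' : fp_eq u u' -> fp_eq v v' -> fp_eq (u ++ v) (u' ++ v')
| fp_oneL : fp_eq [:: inl 1] [::]
| fp_oneR : fp_eq [:: inr 1] [::]
| fp_mulL a a' : fp_eq [:: inl a; inl a'] [:: inl (a * a')]
| fp_mulR b b' : fp_eq [:: inr b; inr b'] [:: inr (b * b')].

Definition fp_eqb : rel (seq (A + B)) := fun u v => `[< fp_eq u v >].

Lemma fp_eqb_refl : reflexive fp_eqb.
Proof. by move=> u; apply/asboolP; exact: fp_refl. Qed.

Lemma fp_eqb_sym : symmetric fp_eqb.
Proof. by move=> u v; apply/asboolP/asboolP; exact: fp_sym. Qed.

Lemma fp_eqb_trans : transitive fp_eqb.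
Proof.
by move=> v u w /asboolP uv /asboolP vw; apply/asboolP; exact: fp_trans uv vw.
Qed.

Canonical fp_equiv := EquivRel fp_eqb fp_eqb_refl fp_eqb_sym fp_eqb_trans.

(* The free product A * B: words in A + B modulo the congruence generated by
   the multiplication tables of A and B. *)
Definition free_product := {eq_quot fp_equiv}.

HB.instance Definition _ := Choice.on free_product.

Definition fp_class (u : seq (A + B)) : free_product :=
  \pi_({eq_quot fp_equiv}) u.
Definition fp_repr (x : free_product) : seq (A + B) :=
  repr (x : {eq_quot fp_equiv}).

Lemma fp_reprK : cancel fp_repr fp_class.
Proof. by move=> x; exact: reprK. Qed.

Lemma fp_classP u v : fp_class u = fp_class v <-> fp_eq u v.
Proof.
by split=> [/eqquotP/asboolP|uv]; [|apply/eqquotP/asboolP].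
Qed.

Lemma fp_repr_class u : fp_eq (fp_repr (fp_class u)) u.
Proof. by apply/fp_classP; rewrite fp_reprK. Qed.

Definition letter_inv (l : A + B) : A + B :=
  match l with inl a => inl a^-1 | inr b => inr b^-1 end.

Definition word_inv (u : seq (A + B)) : seq (A + B) := rev (map letter_inv u).

Definition fp_mul (x y : free_product) : free_product :=
  fp_class (fp_repr x ++ fp_repr y).
Definition fp_one : free_product := fp_class [::].
Definition fp_inv (x : free_product) : free_product :=
  fp_class (word_inv (fp_repr x)).

Lemma fp_mul_class u v : fp_mul (fp_class u) (fp_class v) = fp_class (u ++ v).
Proof. by apply/fp_classP/fp_cat; exact: fp_repr_class. Qed.

Lemma fp_word_invl u : fp_eq (word_inv u ++ u) [::].
Proof.
elim: u => [|l u IHu]; first exact: fp_refl.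
rewrite /word_inv map_cons rev_cons cat_rcons.
have lK : fp_eq [:: letter_inv l; l] [::].
  by case: l => [a|b] /=; [apply: fp_trans (fp_mulL _ _) _
    | apply: fp_trans (fp_mulR _ _) _]; rewrite mulVg;
    [exact: fp_oneL | exact: fp_oneR].
apply: fp_trans IHu; apply: (fp_cat (fp_refl _)).
exact: (fp_cat lK (fp_refl u)).
Qed.

Lemma fp_word_invr u : fp_eq (u ++ word_inv u) [::].
Proof.
have uK : word_inv (word_inv u) = u.
  rewrite /word_inv map_rev revK -map_comp -[RHS]map_id.
  by apply: eq_map => -[a|b] /=; rewrite invgK.
by have := fp_word_invl (word_inv u); rewrite uK.
Qed.

Lemma fp_mulA : associative fp_mul.
Proof.
move=> x y z; rewrite -(fp_reprK x) -(fp_reprK y) -(fp_reprK z).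
by rewrite !fp_mul_class catA.
Qed.

Lemma fp_mul1 : left_id fp_one fp_mul.
Proof. by move=> x; rewrite -(fp_reprK x) fp_mul_class cat0s. Qed.

Lemma fp_mulr1 : right_id fp_one fp_mul.
Proof. by move=> x; rewrite -(fp_reprK x) fp_mul_class cats0. Qed.

Lemma fp_mulV : left_inverse fp_one fp_inv fp_mul.
Proof.
move=> x; rewrite -[X in fp_mul _ X](fp_reprK x) fp_mul_class.
by apply/fp_classP; exact: fp_word_invl.
Qed.

Lemma fp_mulrV : right_inverse fp_one fp_inv fp_mul.
Proof.
move=> x; rewrite -[X in fp_mul X _](fp_reprK x) fp_mul_class.
by apply/fp_classP; exact: fp_word_invr.
Qed.

HB.instance Definition _ :=
  isGroup.Build free_product fp_mulA fp_mul1 fp_mulr1 fp_mulV fp_mulrV.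

End FreeProduct.

Definition Zgrp : groupType := Algebra.to_multiplicative int.
Definition Z2grp : groupType := (Zgrp * Zgrp)%type.
Definition Z2_free_Z : groupType := free_product Z2grp Zgrp.

Variant one_manifold := Interval | Circle.

Section Diffeomorphisms.
Variable R : realType.

Definition unit_interval : Type := {x : R | 0 <= x <= 1}.

Definition integers : zmodClosed R :=
  GRing.ZmodClosed.clone R (@Num.int_num_subdef _ : {pred R}) _.

Lemma integersE (x : R) : (x \in integers) = (x \is a Num.int).
Proof. by []. Qed.

Definition circle : Type := Quotient.quot integers.

Definition point (X : one_manifold) : Type :=
  match X with Interval => unit_interval | Circle => circle end.

(* [coord y p]: the real number y is a coordinate of the point p; the inclusion
   of [0,1] in R and the local inverses of R -> R/Z are the charts of I and
   S^1. *)
Definition coord (X : one_manifold) : R -> point X -> Prop :=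
  match X with
  | Interval => fun y (p : unit_interval) => y = val p
  | Circle => fun y (p : circle) => \pi_(Quotient.quot integers) y = p
  end.

Definition lifts_near (X : one_manifold) (f : point X -> point X) (x : R)
    (F : R -> R) : Prop :=
  \forall y \near x, forall p : point X, coord y p -> coord (F y) (f p).

Definition C1_near (F : R -> R) (x : R) : Prop :=
  \forall y \near x, derivable F y 1 /\ {for y, continuous (derive1 F)}.

(* f is C^1 and orientation preserving (positive derivative), in charts. At an endpoint of [0,1],
   F is a C^1 extension of f to a neighbourhood in R, so that derive1 F x is the
   one-sided derivative of f. *)
Definition C1_pos (X : one_manifold) (f : point X -> point X) : Prop :=
  forall (x : R) (p : point X), coord x p ->
    exists F : R -> R, [/\ lifts_near f x F, C1_near F x & 0 < derive1 F x].

Record diff1p (X : one_manifold) := Diff1p {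
  diff_fun :> point X -> point X;
  diff_inv : point X -> point X;
  diff_funK : cancel diff_fun diff_inv;
  diff_invK : cancel diff_inv diff_fun;
  diff_fun_C1 : C1_pos diff_fun;
  diff_inv_C1 : C1_pos diff_inv
}.

HB.instance Definition _ X := gen_eqMixin (diff1p X).
HB.instance Definition _ X := gen_choiceMixin (diff1p X).

Section Group.
Variable X : one_manifold.
Implicit Types f g h : diff1p X.

Lemma diff_ext f g : f =1 g -> f = g.
Proof.
case: f g => [f f' fK f'K cf cf'] [g g' gK g'K cg cg'] /= /funext fg.
subst g; have ff' : f' = g'.
  by apply/funext => x; rewrite -{1}(g'K x) fK.
by subst g'; congr Diff1p; exact: Prop_irrelevance.
Qed.

Lemma C1_pos_id : C1_pos (@id (point X)).
Proof.
move=> x p xp; exists id; split.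
- by rewrite /lifts_near; near=> y => q.
- rewrite /C1_near; near=> y; split; first exact: derivable_id.
  have -> : derive1 (id : R -> R) = cst 1.
    by apply/funext => z; exact: derive1_id.
  exact: cst_continuous.
- by rewrite derive1_id ltr01.
Unshelve. all: by end_near. Qed.

Lemma C1_pos_comp (f g : point X -> point X) :
  C1_pos f -> C1_pos g -> C1_pos (f \o g).
Proof.
move=> Cf Cg x p xp.
have [G [Gg CG G0]] := Cg x p xp.
have gxp : coord (G x) (g p) by exact: (nbhs_singleton Gg).
have [F [Ff CF F0]] := Cf _ _ gxp.
have Gcont y : derivable G y 1 -> {for y, continuous G}.
  by move=> /derivable1_diffP/differentiable_continuous.
have [dG _] := nbhs_singleton CG; have [dF _] := nbhs_singleton CF.
exists (F \o G); split.
- have FfG : \forall y \near x, forall q : point X,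
      coord (G y) q -> coord (F (G y)) (f q) by exact: Gcont _ dG _ Ff.
  by apply: filterS2 Gg FfG => y Hg Hf q /Hg; exact: Hf.
- have CFG : \forall y \near x, C1_near F (G y).
    by apply: (Gcont _ dG (C1_near F)); exact: nbhs_interior CF.
  have CGG : \forall y \near x, C1_near G y by exact: nbhs_interior CG.
  apply: filterS2 CFG CGG => y CFy CGy.
  have [dGy cGy] := nbhs_singleton CGy; have [dFy cFy] := nbhs_singleton CFy.
  split.
    move/derivable1_diffP: dGy => dGy; move/derivable1_diffP: dFy => dFy.
    exact/derivable1_diffP/differentiable_comp.
  have CFGy : \forall z \near y,
    derivable F (G z) 1 /\ {for G z, continuous (derive1 F)}.
    exact: Gcont _ dGy _ CFy.
  have E : \forall z \near y,
      derive1 F (G z) * derive1 G z = derive1 (F \o G) z.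
    move: CGy; rewrite /C1_near => CGy.
    apply: filterS2 CFGy CGy => z [dFz _] [dGz _].
    exact/esym/derive1_comp.
  rewrite /prop_for /continuous_at (derive1_comp dGy dFy).
  apply: cvg_trans (near_eq_cvg E) _.
  apply: cvgM; last exact: cGy.
  by apply: (@continuous_comp _ _ _ G (derive1 F)); [exact: Gcont | exact: cFy].
- by rewrite (derive1_comp dG dF) mulr_gt0.
Qed.

Definition diff_one : diff1p X :=
  @Diff1p X id id (fun=> erefl) (fun=> erefl) C1_pos_id C1_pos_id.

Definition diff_mul f g : diff1p X :=
  @Diff1p X (f \o g) (diff_inv g \o diff_inv f)
    (can_comp (@diff_funK X f) (@diff_funK X g))
    (can_comp (@diff_invK X g) (@diff_invK X f))
    (C1_pos_comp (@diff_fun_C1 X f) (@diff_fun_C1 X g))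
    (C1_pos_comp (@diff_inv_C1 X g) (@diff_inv_C1 X f)).

Definition diff_opp f : diff1p X :=
  @Diff1p X (diff_inv f) f (@diff_invK X f) (@diff_funK X f)
    (@diff_inv_C1 X f) (@diff_fun_C1 X f).

Lemma diff_mulA : associative diff_mul.
Proof. by move=> f g h; exact: diff_ext. Qed.

Lemma diff_mul1 : left_id diff_one diff_mul.
Proof. by move=> f; exact: diff_ext. Qed.

Lemma diff_mulr1 : right_id diff_one diff_mul.
Proof. by move=> f; exact: diff_ext. Qed.

Lemma diff_mulV : left_inverse diff_one diff_opp diff_mul.
Proof. by move=> f; apply: diff_ext => x; exact: diff_funK. Qed.

Lemma diff_mulrV : right_inverse diff_one diff_opp diff_mul.
Proof. by move=> f; apply: diff_ext => x; exact: diff_invK. Qed.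

HB.instance Definition _ :=
  isGroup.Build (diff1p X) diff_mulA diff_mul1 diff_mulr1 diff_mulV diff_mulrV.

Definition supp f : set (point X) := [set x | f x <> x].

End Group.
End Diffeomorphisms.

(* Main.v *)
Require Import Defs.
From HB Require Import structures.
From mathcomp Require Import all_boot all_order all_algebra.
From mathcomp Require Import all_classical all_reals all_analysis.
From mathcomp Require Import ring lra zify.

Set Implicit Arguments.
Unset Strict Implicit.
Unset Printing Implicit Defensive.

Import Order.TTheory GRing.Theory Num.Theory.
Import numFieldNormedType.Exports.

Local Open Scope classical_set_scope.
Local Open Scope ring_scope.

(* In Z^2 * Z, commutation is transitive on nontrivial elements, and an element
   commuting with its conjugate by h commutes with h; both are read off from
   representations a -> 1 + 2i, b -> a^N, t -> 1 + 2j by integer quaternions.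
   Suppose that a, b, t act on an interval, and let a', b' be the conjugates of
   a, b by t. A word in a, b, a', b' which dies whenever one of the four letters
   is erased acts trivially near each common fixed point p of the letters: an
   orbit using all four letters spans both a point fixed by a, b and a point
   fixed by a', b', and by C^1 regularity the displacements near p are too small
   to travel from one to the other in a bounded number of steps. The support of
   such a word w thus lies in finitely many gaps of the common fixed set. Pushing
   it off itself in one gap by some h, the commutator of w and its conjugate by h
   meets fewer gaps, hence is trivial by induction; so w commutes with h, and w is
   trivial on that gap. Hence all these words are trivial, which forces a and t to
   commute. On the circle, a and b have a common fixed point x, also fixed by one of
   the conjugates of a, b by t, because t^-1 x is fixed by a or b; this conjugate
   replaces t and the circle is cut at x. *)

(** * Words in two pairs of letters, and line actions *)

Section Words.
Local Open Scope group_scope.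
Variable G : groupType.
Implicit Types (rho : bool -> bool -> G) (w : seq (bool * bool * bool)).

(* The letter (s, i, v) stands for rho s i, inverted when v holds. *)
Definition letter_val rho (c : bool * bool * bool) : G :=
  if c.2 then (rho c.1.1 c.1.2)^-1 else rho c.1.1 c.1.2.

Definition word_val rho w : G := foldr (fun c g => letter_val rho c * g) 1 w.

(** Erasing evaluates a letter at 1 instead of deleting it, so the word keeps its length and its
    suffixes. *)
Definition erase (s i : bool) rho : bool -> bool -> G :=
  fun s' i' => if (s' == s) && (i' == i) then 1 else rho s' i'.

Definition letter_flip (c : bool * bool * bool) := (c.1, ~~ c.2).

Definition word_flip w := rev (map letter_flip w).

Definition word_comm w w' := w ++ w' ++ word_flip w ++ word_flip w'.

Lemma word_val_cat rho w w' :
  word_val rho (w ++ w') = word_val rho w * word_val rho w'.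
Proof. by elim: w => [|c w IHw] /=; rewrite ?mul1g // IHw mulgA. Qed.

Lemma word_val_flip rho w : word_val rho (word_flip w) = (word_val rho w)^-1.
Proof.
elim: w => [|c w IHw]; first by rewrite invg1.
rewrite /word_flip map_cons rev_cons -cats1 word_val_cat -/(word_flip w) IHw.
rewrite /= invgM mulg1; congr (_ * _).
by case: c => -[s i] []; rewrite /letter_val /= ?invgK.
Qed.

Lemma word_val_comm rho w w' : let x := word_val rho w in
  let y := word_val rho w' in word_val rho (word_comm w w') = x * y / x / y.
Proof. by move=> x y; rewrite !word_val_cat !word_val_flip !mulgA. Qed.

Lemma word_val_comm1 rho w w' : commute (word_val rho w) (word_val rho w') ->
  word_val rho (word_comm w w') = 1.
Proof. by move=> cww'; rewrite word_val_comm cww' mulgK mulgV. Qed.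

Lemma word_val_comm_neq1 rho w w' :
  ~ commute (word_val rho w) (word_val rho w') ->
  word_val rho (word_comm w w') <> 1.
Proof.
move=> ncww'; rewrite word_val_comm => e; apply: ncww'.
by apply/eqP; rewrite -divg_eq1 invgM mulgA; apply/eqP.
Qed.

End Words.

Section LineActions.
Variables (R : realType) (G : groupType).
Implicit Types (H : set G) (act : G -> R -> R).

(** Only [H] acts: on the circle it will be the stabilizer of the cut point. Continuity follows from
    monotonicity and the inverses in [H]. *)
Record line_action H act : Prop := LineAction {
  la_subgroup : is_subgroup H;
  la_one : act 1%g =1 id;
  la_mul : forall g h, H g -> H h -> forall x, act (g * h)%g x = act g (act h x);
  la_lt : forall g, H g -> forall x y, x < y -> act g x < act g y
}.

(** This is all that the dynamics retains of C^1 regularity: fixed points accumulating at [p] from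
    the right force right derivative 1 there, so displacements have a small Lipschitz constant. It
    is one-sided because extensions by the identity may have a corner at the ends. *)
Definition right_tame (f : R -> R) : Prop := forall p,
  (forall eta, 0 < eta -> exists2 y, p < y < p + eta & f y = y) ->
  forall eps, 0 < eps -> exists2 del, 0 < del &
    forall x y, p < x < p + del -> p < y < p + del ->
      `|(f x - x) - (f y - y)| <= eps * `|x - y|.

Definition left_tame (f : R -> R) : Prop := right_tame (fun x => - f (- x)).

Definition reflected act : G -> R -> R := fun g x => - act g (- x).

Lemma line_action_reflected H act :
  line_action H act -> line_action H (reflected act).
Proof.
case=> sH a1 aM alt; split=> // [x|g h Hg Hh x|g Hg x y xy].
- by rewrite /reflected a1 opprK.
- by rewrite /reflected aM // opprK.
- by rewrite /reflected ltrN2 alt // ltrN2.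
Qed.

(** Connectedness of an interval: the supremum of the points of [A] in [[x, y]] lies in neither open
    set. *)
Lemma separating_point (A B : set R) (x y : R) :
  (forall z, A z -> exists2 e, 0 < e & forall z', `|z' - z| < e -> A z') ->
  (forall z, B z -> exists2 e, 0 < e & forall z', `|z' - z| < e -> B z') ->
  (forall z, A z -> B z -> False) -> x < y -> A x -> B y ->
  exists2 z, x < z < y & ~ A z /\ ~ B z.
Proof.
move=> oA oB AB xy Ax By.
pose E := [set s | x <= s <= y /\ A s].
have Ex : E x by split=> //; rewrite lexx ltW.
have hE : has_sup E by split; [exists x | exists y => s [/andP[]]].
set z := sup E.
have xz : x <= z by exact: ub_le_sup hE.2 _ Ex.
have zy : z <= y by apply: ge_sup; [exists x | move=> s [/andP[]]].
have nBz : ~ B z.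
  move=> /oB[e e0 Be]; have [s [/andP[xs sy] As] zs] := sup_adherent e0 hE.
  have sz : s <= z by apply: ub_le_sup hE.2 _ _; split=> //; rewrite xs.
  by apply: (AB s As); apply: Be; rewrite -/z in zs; rewrite ler0_norm; lra.
have zy' : z < y by rewrite lt_neqAle zy andbT; apply/eqP => e; rewrite e in nBz.
have nAz : ~ A z.
  move=> /oA[e e0 Ae]; pose s := Num.min y (z + e / 2).
  have zs : z < s by rewrite /s lt_min zy' /=; lra.
  have se : s <= z + e / 2 by rewrite /s ge_min lexx orbT.
  have sy : s <= y by rewrite /s ge_min lexx.
  have : s <= z.
    apply: ub_le_sup hE.2 _ _; split; first by apply/andP; split=> //; lra.
    by apply: Ae; rewrite gtr0_norm; lra.
  by lra.
exists z => //; rewrite zy' andbT lt_neqAle xz andbT.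
by apply/eqP => e; rewrite e in Ax.
Qed.

Section Action.
Variables (H : set G) (act : G -> R -> R).
Hypothesis Hact : line_action H act.

Lemma la_sub1 : H 1%g. Proof. by case: (la_subgroup Hact). Qed.
Lemma la_subM g h : H g -> H h -> H (g * h)%g.
Proof. by case: (la_subgroup Hact) => _ HM _; exact: HM. Qed.
Lemma la_subV g : H g -> H g^-1%g.
Proof. by case: (la_subgroup Hact) => _ _ HV; exact: HV. Qed.

Lemma la_invK g : H g -> cancel (act g) (act g^-1%g).
Proof.
by move=> Hg x; have HV := la_subV Hg; rewrite -(la_mul Hact) ?mulVg ?(la_one Hact).
Qed.

Lemma la_Kinv g : H g -> cancel (act g^-1%g) (act g).
Proof.
by move=> Hg x; have HV := la_subV Hg; rewrite -(la_mul Hact) ?mulgV ?(la_one Hact).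
Qed.

Lemma la_ltE g x y : H g -> (act g x < act g y) = (x < y).
Proof.
move=> Hg; apply/idP/idP; last by move=> xy; exact: (la_lt Hact).
by move/(la_lt Hact (la_subV Hg)); rewrite !la_invK.
Qed.

Lemma la_leE g x y : H g -> (act g x <= act g y) = (x <= y).
Proof. by move=> Hg; rewrite !leNgt la_ltE. Qed.

Lemma la_fixV g x : H g -> act g x = x -> act g^-1%g x = x.
Proof. by move=> Hg gx; rewrite -{1}gx la_invK. Qed.

Lemma la_conj g h x : H g -> H h ->
  act (h * g / h)%g x = act h (act g (act h^-1%g x)).
Proof.
move=> Hg Hh.
by rewrite !(la_mul Hact) //; do ?[apply: la_subM => //]; exact: la_subV.
Qed.

(** With [m] halfway between [z] and [act h z], every [y] strictly between [act h^-1%g m] and [m]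
    satisfies [y < m < act h y]. Points moved to the left are handled through the inverse. *)
Lemma la_supp_open g x : H g -> act g x <> x ->
  exists2 e, 0 < e & forall y, `|y - x| < e -> act g y <> y.
Proof.
suff main h z : H h -> z < act h z ->
    exists2 e, 0 < e & forall y, `|y - z| < e -> y < act h y.
  move=> Hg /eqP; rewrite neq_lt => /orP[gx|xg].
    have xg : x < act g^-1%g x by rewrite -(la_ltE _ _ Hg) la_Kinv.
    have [e e0 He] := main _ _ (la_subV Hg) xg.
    exists e => // y /He yg gy.
    by move: yg; rewrite (la_fixV Hg gy) ltxx.
  have [e e0 He] := main _ _ Hg xg; exists e => // y /He yg gy.
  by rewrite gy ltxx in yg.
move=> Hh zh; pose m := (z + act h z) / 2.
have zm : z < m by rewrite /m; lra.
have hm : act h^-1%g m < z.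
  by rewrite -(la_ltE _ _ Hh) la_Kinv // /m; lra.
exists (Num.min (m - z) (z - act h^-1%g m)).
  by rewrite lt_min; apply/andP; split; lra.
move=> y; rewrite lt_min => /andP[]; rewrite !ltr_norml => /andP[_ y1] /andP[y2 _].
apply: (@lt_trans _ _ m); first by lra.
by rewrite -[X in X < _](la_Kinv Hh) la_ltE //; lra.
Qed.

Lemma la_near_right g p del : H g -> act g p = p -> 0 < del ->
  exists2 eta, 0 < eta & forall x, p < x < p + eta -> p < act g x < p + del.
Proof.
move=> Hg gp d0; exists (act g^-1%g (p + del) - p).
  by rewrite subr_gt0 -(la_ltE _ _ Hg) gp la_Kinv //; lra.
move=> x /andP[px xd]; apply/andP; split; first by rewrite -{1}gp la_ltE.
by rewrite -(la_Kinv Hg (p + del)) la_ltE //; lra.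
Qed.

End Action.

Section WordActions.
Variables (H : set G) (act : G -> R -> R) (rho : bool -> bool -> G).
Hypothesis Hact : line_action H act.
Hypothesis Hrho : forall s i, H (rho s i).
Implicit Type w : seq (bool * bool * bool).

Lemma letter_val_in c : H (letter_val rho c).
Proof. by rewrite /letter_val; case: ifP => // _; exact: (la_subV Hact). Qed.

Lemma word_val_in w : H (word_val rho w).
Proof.
elim: w => [|c w IHw] /=; first exact: la_sub1 Hact.
by apply: la_subM Hact _ _ _ _ => //; exact: letter_val_in.
Qed.

Lemma act_word_cons c w x :
  act (word_val rho (c :: w)) x = act (letter_val rho c) (act (word_val rho w) x).
Proof. by rewrite /= (la_mul Hact) //; [exact: letter_val_in|exact: word_val_in]. Qed.

Lemma act_word_cat w w' x :
  act (word_val rho (w ++ w')) x = act (word_val rho w) (act (word_val rho w') x).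
Proof. by rewrite word_val_cat (la_mul Hact) //; exact: word_val_in. Qed.

Lemma erase_in s i s' i' : H (erase s i rho s' i').
Proof. by rewrite /erase; case: ifP => // _; exact: la_sub1 Hact. Qed.

Lemma letter_val_fix c x : act (rho c.1.1 c.1.2) x = x ->
  act (letter_val rho c) x = x.
Proof. by rewrite /letter_val; case: ifP => // _; exact: (la_fixV Hact). Qed.

Lemma word_val_fix w x : (forall s i, act (rho s i) x = x) ->
  act (word_val rho w) x = x.
Proof.
move=> fx; elim: w => [|c w IHw]; first exact: la_one Hact _.
by rewrite act_word_cons IHw letter_val_fix.
Qed.

End WordActions.

(** Words act from their last letter, so the orbit of [x] consists of its images under the suffixes
    [drop n w]; a letter fixing all of them can be replaced by 1. *)
Lemma act_erase H act rho s i w x : line_action H act ->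
  (forall s i, H (rho s i)) ->
  (forall n, act (rho s i) (act (word_val rho (drop n w)) x) =
             act (word_val rho (drop n w)) x) ->
  act (word_val rho w) x = act (word_val (erase s i rho) w) x.
Proof.
move=> Hact Hrho; elim: w => // c w IHw fx.
have Her := erase_in Hact Hrho s i.
rewrite (act_word_cons Hact Hrho) (act_word_cons Hact Her) -IHw; last first.
  by move=> n; exact: fx n.+1.
have := fx 1; rewrite /= drop0 => fx1.
case: c {fx} => -[s' i'] v; rewrite /letter_val /erase /=.
case: (boolP (_ && _)) => [/andP[/eqP -> /eqP ->]|//].
case: v; last by rewrite fx1 (la_one Hact).
by rewrite invg1 (la_one Hact) (la_fixV Hact).
Qed.

(** * Orbits of bounded length near a common fixed point *)

Section Tame.
Variables (H : set G) (act : G -> R -> R) (rho : bool -> bool -> G).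
Hypothesis Hact : line_action H act.
Hypothesis Hrho : forall s i, H (rho s i).
Hypothesis rho_disjoint : forall s x,
  act (rho s true) x = x \/ act (rho s false) x = x.

Lemma orbit_near_right p del w : (forall s i, act (rho s i) p = p) -> 0 < del ->
  exists2 eta, 0 < eta & forall x, p < x < p + eta ->
    forall n, p < act (word_val rho (drop n w)) x < p + del.
Proof.
move=> fp d0; elim: w => [|c w [e1 e10 He1]].
  by exists del => // x px n; rewrite (la_one Hact).
have wp := word_val_fix Hact Hrho (c :: w) fp.
have [e2 e20 He2] := la_near_right Hact (word_val_in Hact Hrho (c :: w)) wp d0.
exists (Num.min e1 e2); first by rewrite lt_min e10.
move=> x /andP[px]; rewrite addr_minr lt_min => /andP[x1 x2] [|n].
  by rewrite drop0; apply: He2; rewrite px.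
by rewrite /=; apply: He1; rewrite px.
Qed.

(** Only the bound has to stay in [[u, v]]: by monotonicity a letter carries the point below the
    image of the bound, which exceeds the bound by at most [d]. *)
Lemma slow_word_le u v d w x : 0 <= d ->
  (forall c y, u <= y <= v -> `|act (letter_val rho c) y - y| <= d) ->
  u + (size w)%:R * d <= v -> x <= u ->
  act (word_val rho w) x <= u + (size w)%:R * d.
Proof.
move=> d0 slow wv xu; elim: w wv => [|c w IHw] wv.
  by rewrite mul0r addr0 (la_one Hact).
rewrite (act_word_cons Hact Hrho) /=; move: wv; rewrite /= -natr1 mulrDl mul1r => wv.
have sw : u + (size w)%:R * d <= v by lra.
have := IHw sw; rewrite -(la_leE Hact _ _ (letter_val_in Hact Hrho c)).
have : u <= u + (size w)%:R * d <= v by rewrite sw lerDl mulr_ge0.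
move=> /(slow c); rewrite ler_norml => /andP[_]; lra.
Qed.

Lemma slow_word_ge u v d w x : 0 <= d ->
  (forall c y, u <= y <= v -> `|act (letter_val rho c) y - y| <= d) ->
  u <= v - (size w)%:R * d -> v <= x ->
  v - (size w)%:R * d <= act (word_val rho w) x.
Proof.
move=> d0 slow wv vx; elim: w wv => [|c w IHw] wv.
  by rewrite mul0r subr0 (la_one Hact).
rewrite (act_word_cons Hact Hrho) /=; move: wv; rewrite /= -natr1 mulrDl mul1r => wv.
have sw : u <= v - (size w)%:R * d by lra.
have := IHw sw; rewrite -(la_leE Hact _ _ (letter_val_in Hact Hrho c)).
have : u <= v - (size w)%:R * d <= v by rewrite sw gerBl mulr_ge0.
move=> /(slow c); rewrite ler_norml => /andP[+ _]; lra.
Qed.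

(** Of the two suffixes one extends the other by at most [size w] letters, too few steps of length
    [d] to cross [[u, v]] in either direction. *)
Lemma slow_orbit u v d w x n m : 0 <= d ->
  (forall c y, u <= y <= v -> `|act (letter_val rho c) y - y| <= d) ->
  (size w)%:R * d < v - u ->
  act (word_val rho (drop n w)) x <= u ->
  v <= act (word_val rho (drop m w)) x -> False.
Proof.
move=> d0 slow wd xu vx.
have sz k w' : (size (take k (drop w' w)))%:R * d <= (size w)%:R * d.
  apply: ler_wpM2r => //; rewrite ler_nat size_take_min size_drop.
  by rewrite (leq_trans (geq_minr _ _)) // leq_subr.
have split_drop k l : (k <= l)%N -> drop k w = take (l - k) (drop k w) ++ drop l w.
  by move=> kl; rewrite -{2}(subnK kl) -drop_drop cat_take_drop.
have [nm|mn] := leqP n m.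
  move: xu; rewrite (split_drop _ _ nm) (act_word_cat Hact Hrho).
  have := sz (m - n)%N n; set w' := take _ _ => szw.
  have hw : u <= v - (size w')%:R * d by lra.
  by have := slow_word_ge d0 slow hw vx; lra.
move: vx; rewrite (split_drop _ _ (ltnW mn)) (act_word_cat Hact Hrho).
have := sz (n - m)%N m; set w' := take _ _ => szw.
have hw : u + (size w')%:R * d <= v by lra.
by have := slow_word_le d0 slow hw xu; lra.
Qed.

(* A moving orbit must meet all four supports, so it spans a common fixed point
   of each pair; the displacements between these two points are too small for
   an orbit of bounded length to cross from one to the other. *)
Lemma trivial_on_right p w : (forall g, H g -> right_tame (act g)) ->
  (forall s i, act (rho s i) p = p) ->
  (forall s i, word_val (erase s i rho) w = 1%g) ->
  exists2 eta, 0 < eta & forall x, p < x < p + eta -> act (word_val rho w) x = x.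
Proof.
move=> tame fp erw.
(* With this value, [size w] displacements of at most [eps * d] add up to less than [d]. *)
pose eps : R := ((size w).+1)%:R^-1.
have eps0 : 0 < eps by rewrite invr_gt0 ltr0Sn.
(* Either common fixed points of the pair [s] accumulate at [p] and tameness applies, or [del] is so
   small that none is within reach and the premise fails. *)
have near_lip s : exists2 del, 0 < del &
    (exists2 u, p < u < p + del & forall i, act (rho s i) u = u) ->
    forall i v x y, p < x < p + del -> p < y < p + del ->
    let f := act (letter_val rho (s, i, v)) in
    `|(f x - x) - (f y - y)| <= eps * `|x - y|.
  have [acc|] := pselect (forall eta, 0 < eta ->
      exists2 y, p < y < p + eta & forall i, act (rho s i) y = y).
    have lip i v : exists2 del, 0 < del & forall x y,
        p < x < p + del -> p < y < p + del ->
        let f := act (letter_val rho (s, i, v)) in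
        `|(f x - x) - (f y - y)| <= eps * `|x - y|.
      apply: (tame _ (letter_val_in Hact Hrho _)) eps0 => eta /acc[y py fy].
      by exists y => //; apply: (letter_val_fix Hact Hrho).
    have [d1 d10 h1] := lip true true; have [d2 d20 h2] := lip true false.
    have [d3 d30 h3] := lip false true; have [d4 d40 h4] := lip false false.
    exists (Num.min (Num.min d1 d2) (Num.min d3 d4)).
      by rewrite !lt_min d10 d20 d30.
    move=> _ i v x y; rewrite !addr_minr !lt_min.
    move=> /andP[px /andP[/andP[x1 x2] /andP[x3 x4]]].
    move=> /andP[py /andP[/andP[y1 y2] /andP[y3 y4]]].
    by case: i v => -[]; [apply: h1|apply: h2|apply: h3|apply: h4];
      rewrite ?px ?py.
  move=> nacc; have [eta eta0 neta] : exists2 eta, 0 < eta &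
      ~ exists2 y, p < y < p + eta & forall i, act (rho s i) y = y.
    apply: contrapT => h; apply: nacc => eta eta0.
    by apply: contrapT => h'; apply: h; exists eta.
  by exists eta => // /neta.
have [d1 d10 h1] := near_lip true; have [d2 d20 h2] := near_lip false.
pose del := Num.min d1 d2.
have del0 : 0 < del by rewrite lt_min d10.
have [eta eta0 orb] := orbit_near_right w fp del0.
exists eta => // x px; apply: contrapT => wx.
pose O n := act (word_val rho (drop n w)) x.
have Oin n : p < O n < p + del by exact: orb.
have moved s i : exists n, act (rho s i) (O n) <> O n.
  apply: contrapT => nm; apply: wx.
  rewrite (act_erase (s := s) (i := i) Hact Hrho) ?erw ?(la_one Hact) // => n.
  by apply: contrapT => nf; apply: nm; exists n.
(* The two letters of a pair have disjoint open supports, both visited by the orbit, so some point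
   between two visits lies in neither. *)
have mid s : exists u, [/\ forall i, act (rho s i) u = u,
    exists n, O n < u & exists m, u < O m].
  have opn i z : [set z | act (rho s i) z <> z] z -> exists2 e, 0 < e &
      forall z', `|z' - z| < e -> [set z | act (rho s i) z <> z] z'.
    by move=> /(la_supp_open Hact (Hrho s i)).
  have dis z : act (rho s true) z <> z -> act (rho s false) z <> z -> False.
    by case: (rho_disjoint s z).
  have [n nO] := moved s true; have [m mO] := moved s false.
  have fixed u : ~ act (rho s true) u <> u -> ~ act (rho s false) u <> u ->
      forall i, act (rho s i) u = u by move=> /contrapT ? /contrapT ? [].
  have [nm|mn|e] := ltgtP (O n) (O m).
  - have [u /andP[nu um] [fu fu']] :=
      separating_point (opn true) (opn false) dis nm nO mO.
    by exists u; split; [exact: fixed|exists n|exists m].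
  - have [u /andP[nu um] [fu fu']] := separating_point (opn false) (opn true)
      (fun z h h' => dis z h' h) mn mO nO.
    by exists u; split; [exact: fixed|exists m|exists n].
  - by case: (dis _ nO); rewrite e.
have [u [fu [n1 un1] [m1 um1]]] := mid true.
have [v [fv [n2 vn2] [m2 vm2]]] := mid false.
have uin : p < u < p + del.
  by have /andP[? ?] := Oin n1; have /andP[? ?] := Oin m1; apply/andP; split; lra.
have vin : p < v < p + del.
  by have /andP[? ?] := Oin n2; have /andP[? ?] := Oin m2; apply/andP; split; lra.
have lip s i b y z : p < y < p + del -> p < z < p + del ->
    let f := act (letter_val rho (s, i, b)) in
    `|(f y - y) - (f z - z)| <= eps * `|y - z|.
  rewrite /del !addr_minr !lt_min => /andP[py /andP[y1 y2]] /andP[pz /andP[z1 z2]].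
  move: uin vin; rewrite /del !addr_minr !lt_min.
  move=> /andP[pu /andP[u1 u2]] /andP[pv /andP[v1 v2]].
  case: s; first by apply: h1; [exists u => //; rewrite pu|rewrite py|rewrite pz].
  by apply: h2; [exists v => //; rewrite pv|rewrite py|rewrite pz].
(* Each letter fixes [u] or [v], according to its pair; the Lipschitz bound relative to that point
   controls its displacement on [[m, M]]. *)
have slow m M : m <= u <= M -> m <= v <= M -> p < m -> M < p + del ->
    forall c y, m <= y <= M -> `|act (letter_val rho c) y - y| <= eps * (M - m).
  move=> /andP[mu uM] /andP[mv vM] pm Mp [[s i] b] y /andP[my yM].
  have yin : p < y < p + del by apply/andP; split; lra.
  pose z := if s then u else v.
  have zin : p < z < p + del by rewrite /z; case: (s).
  have fz : act (letter_val rho (s, i, b)) z = z.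
    by apply: (letter_val_fix Hact Hrho); rewrite /z; case: (s).
  have := lip s i b y z yin zin; rewrite /= fz subrr subr0.
  move=> /le_trans -> //; rewrite ler_pM2l // ler_norml.
  have mz : m <= z by rewrite /z; case: (s).
  have zM : z <= M by rewrite /z; case: (s).
  by apply/andP; split; lra.
have /andP[pu up] := uin; have /andP[pv vp] := vin.
have szeps d : 0 < d -> (size w)%:R * (eps * d) < d.
  move=> d0; rewrite mulrA gtr_pMl // /eps ltr_pdivrMr ?ltr0Sn // mul1r ltr_nat.
  by [].
have [uv|vu|e] := ltgtP u v.
- apply: (@slow_orbit u v (eps * (v - u)) w x n1 m2); [| | |exact: ltW|exact: ltW].
  + by rewrite mulr_ge0 // ?subr_ge0 ltW.
  + by apply: slow => //; rewrite lexx ltW.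
  + by apply: szeps; rewrite subr_gt0.
- apply: (@slow_orbit v u (eps * (u - v)) w x n2 m1); [| | |exact: ltW|exact: ltW].
  + by rewrite mulr_ge0 // ?subr_ge0 ltW.
  + by apply: slow => //; rewrite lexx ltW.
  + by apply: szeps; rewrite subr_gt0.
(* If the two points coincide, all letters fix [u], so the orbit cannot visit both sides of it. *)
- have fuv s i : act (rho s i) u = u by case: s => //; rewrite e.
  have side n : (O n < u) = (x < u).
    rewrite -{1}(word_val_fix Hact Hrho (drop n w) fuv).
    by rewrite (la_ltE Hact) //; exact: word_val_in Hact Hrho _.
  by move: (un1) (um1); rewrite side -(side m1) => ?; lra.
Qed.

End Tame.
End LineActions.

(** * Gaps of the common fixed set *)

Section Gaps.
Variables (R : realType) (G : groupType) (H : set G) (act : G -> R -> R).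
Hypothesis Hact : line_action H act.

Definition global_fix : set R := [set x | forall g, H g -> act g x = x].

Definition gap (I : R * R) : Prop :=
  [/\ I.1 < I.2, global_fix I.1, global_fix I.2 &
      forall x, I.1 < x < I.2 -> ~ global_fix x].

Definition near_trivial (w : G) : Prop := forall p, global_fix p ->
  exists u v, u < p < v /\ forall x, u < x < v -> act w x = x.

Lemma near_trivialM g h : H g -> H h ->
  near_trivial g -> near_trivial h -> near_trivial (g * h)%g.
Proof.
move=> Hg Hh tg th p fp.
have [u [v [/andP[up pv] guv]]] := tg p fp.
have [u' [v' [/andP[up' pv'] huv]]] := th p fp.
exists (Num.max u u'), (Num.min v v'); rewrite lt_min gt_max up up' pv pv'.
split=> // x; rewrite lt_min gt_max => /andP[/andP[ux ux'] /andP[xv xv']].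
by rewrite (la_mul Hact) // huv ?guv ?ux ?ux'.
Qed.

Lemma near_trivialV g : H g -> near_trivial g -> near_trivial g^-1%g.
Proof.
move=> Hg tg p /tg[u [v [upv guv]]]; exists u, v; split=> // x /guv gx.
exact: (la_fixV Hact).
Qed.

Lemma near_trivialJ g h : H g -> H h ->
  near_trivial g -> near_trivial (h * g / h)%g.
Proof.
move=> Hg Hh tg p fp; have [u [v [/andP[up pv] guv]]] := tg p fp.
exists (act h u), (act h v); split.
  by rewrite -{1 2}(fp h Hh) !(la_ltE Hact) // up.
move=> x /andP[ux xv]; rewrite (la_conj Hact) // guv; first exact: (la_Kinv Hact).
by rewrite -(la_ltE Hact u _ Hh) -(la_ltE Hact _ v Hh) !(la_Kinv Hact Hh) ux.
Qed.

Lemma gap_act I h x : gap I -> H h ->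
  (I.1 < act h x < I.2) = (I.1 < x < I.2).
Proof.
by case=> _ f1 f2 _ Hh; rewrite -{1}(f1 h Hh) -{1}(f2 h Hh) !(la_ltE Hact).
Qed.

Lemma moved_by_H x : ~ global_fix x -> exists2 g, H g & act g x <> x.
Proof.
move=> nf; apply: contrapT => h; apply: nf => g Hg; apply: contrapT => gx.
by apply: h; exists g.
Qed.

(** If no image of [x] exceeded [y], the supremum of the orbit of [x] would be a global fixed point
    inside the gap. *)
Lemma gap_push I x y : gap I -> I.1 < x < I.2 -> y < I.2 ->
  exists2 h, H h & y < act h x.
Proof.
move=> gI /andP[Ix xI] yI; apply: contrapT => npush.
pose E := [set act h x | h in H].
have E0 : E x by exists 1%g; [exact: la_sub1 Hact|exact: la_one Hact _].
have ubE : ubound E y.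
  move=> _ [h Hh <-]; rewrite leNgt; apply/negP => yh; apply: npush.
  by exists h.
have hE : has_sup E by split; [exists x | exists y].
set z := sup E.
have xz : x <= z by exact: ub_le_sup hE.2 _ E0.
have zy : z <= y by apply: ge_sup => //; exists x.
have /moved_by_H[g Hg gz] : ~ global_fix z.
  by case: gI => _ _ _; apply; apply/andP; split; lra.
suff main k : H k -> act k z < z -> False.
  move: gz => /eqP; rewrite neq_lt => /orP[|]; first exact: main.
  move=> zg; apply: (main _ (la_subV Hact Hg)).
  by rewrite -(la_ltE Hact _ _ Hg) (la_Kinv Hact).
move=> Hk kz; have d0 : 0 < z - act k z by lra.
have [_ [h Hh <-]] := sup_adherent d0 hE; rewrite -/z => khx.
have kh : act k z < act h x by lra.
have : act k^-1%g (act h x) <= z.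
  apply: ub_le_sup hE.2 _ _; exists (k^-1 * h)%g.
    by apply: (la_subM Hact) => //; exact: (la_subV Hact).
  by rewrite (la_mul Hact) //; exact: (la_subV Hact).
by rewrite leNgt -(la_ltE Hact _ _ Hk) (la_Kinv Hact) // kh.
Qed.

Lemma global_fix_open x : ~ global_fix x ->
  exists2 e, 0 < e & forall y, `|y - x| < e -> ~ global_fix y.
Proof.
move=> /moved_by_H[g Hg /(la_supp_open Hact Hg)[e e0 He]].
by exists e => // y /He gy fy; apply: gy; exact: fy.
Qed.

Variables l r : R.
Hypothesis act_out : forall g x, H g -> x <= l \/ r <= x -> act g x = x.

(** The endpoints are the nearest global fixed points on either side; they exist because the fixed
    set is closed and contains [l] and [r]. *)
Lemma gap_around x : ~ global_fix x -> exists2 I, gap I & I.1 < x < I.2.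
Proof.
move=> nfx.
have lx : l < x.
  by rewrite ltNge; apply/negP => xl; apply: nfx => g Hg; apply: act_out => //; left.
have xr : x < r.
  by rewrite ltNge; apply/negP => rx; apply: nfx => g Hg; apply: act_out => //; right.
pose A := [set y | y <= x /\ global_fix y].
pose B := [set y | x <= y /\ global_fix y].
have Al : A l by split; [exact: ltW|move=> g Hg; apply: act_out => //; left].
have Br : B r by split; [exact: ltW|move=> g Hg; apply: act_out => //; right].
have hA : has_sup A by split; [exists l | exists x => y []].
have hB : has_inf B by split; [exists r | exists x => y []].
set u := sup A; set v := inf B.
have Au y : A y -> y <= u by exact: ub_le_sup hA.2 _.
have Bv y : B y -> v <= y by move=> By; exact: ge_inf hB.2 _ By.
have ux : u <= x by apply: ge_sup; [exists l | move=> y []].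
have xv : x <= v by apply: lb_le_inf; [exists r | move=> y []].
have fu : global_fix u.
  apply: contrapT => /global_fix_open[e e0 He].
  have [y Ay] := sup_adherent e0 hA; rewrite -/u => uy.
  have yu := Au y Ay; case: Ay => _; apply: He; rewrite ler0_norm; lra.
have fv : global_fix v.
  apply: contrapT => /global_fix_open[e e0 He].
  have [y By] := inf_adherent e0 hB; rewrite -/v => vy.
  have yv := Bv y By; case: By => _; apply: He; rewrite ger0_norm; lra.
have ux' : u < x by rewrite lt_neqAle ux andbT; apply/eqP => e; rewrite e in fu.
have xv' : x < v by rewrite lt_neqAle xv andbT; apply/eqP => e; rewrite -e in fv.
exists (u, v); last by rewrite ux'.
split=> //=; first exact: lt_trans xv'.
move=> y /andP[uy yv] fy; have [yx|xy] := leP y x.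
  by have := Au y (conj yx fy); lra.
by have := Bv y (conj (ltW xy) fy); lra.
Qed.

(** Compactness of [[l, r]] as a supremum argument: a covered initial segment extends past a global
    fixed point because [w] is trivial nearby, and past any other point by adding the gap around
    it. *)
Lemma finite_gap_cover w : H w -> near_trivial w ->
  exists2 s : seq (R * R), (forall I, List.In I s -> gap I) &
    forall x, act w x <> x -> exists2 I, List.In I s & I.1 < x < I.2.
Proof.
move=> Hw tw.
pose E := [set y | exists2 s : seq (R * R), (forall I, List.In I s -> gap I) &
    forall x, x <= y -> act w x <> x -> exists2 I, List.In I s & I.1 < x < I.2].
have El : E l.
  by exists [::] => // x xl []; apply: act_out => //; left.
have [[y [s sg sy] ry]|nE] := pselect (exists2 y, E y & r <= y).
  exists s => // x wx; apply: sy => //; apply: le_trans ry.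
  by rewrite leNgt; apply/negP => rx; apply: wx; apply: act_out => //; right; exact: ltW.
have ubE : ubound E r.
  by move=> y Ey; rewrite leNgt; apply/negP => ry; apply: nE; exists y => //; exact: ltW.
have hE : has_sup E by split; [exists l | exists r].
set c := sup E.
suff [y Ey cy] : exists2 y, E y & c < y.
  by have := ub_le_sup hE.2 Ey; rewrite -/c; lra.
have below u : u < c -> exists2 y, E y & u < y.
  move=> uc; have d0 : 0 < c - u by lra.
  by have [y Ey] := sup_adherent d0 hE; rewrite -/c => uy; exists y => //; lra.
have [fc|/gap_around[I gI /andP[Ic cI]]] := pselect (global_fix c).
  have [u [v [/andP[uc cv] wuv]]] := tw c fc.
  have [y [s sg sy] uy] := below u uc.
  exists ((c + v) / 2); last by lra.
  exists s => // x xv wx; have [xy|yx] := leP x y; first exact: sy.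
  by case: wx; apply: wuv; apply/andP; split; lra.
have [y [s sg sy] uy] := below _ Ic.
exists ((c + I.2) / 2); last by lra.
exists (I :: s); first by move=> J [<-|/sg].
move=> x xv wx; have [xy|yx] := leP x y.
  by have [J Js xJ] := sy x xy wx; exists J => //; right.
by exists I; [left|apply/andP; split; lra].
Qed.

Hypothesis act_faithful : forall g, H g -> act g =1 id -> g = 1%g.
Hypothesis conj_commute : forall w h : G,
  commute w (h * w / h)%g -> commute w h.

(** An injective map sends moved points to moved points, so at each [x] one of the two maps fixes
    both [x] and its image by the other. *)
Lemma commute_disjoint w h I : H w -> H h -> gap I ->
  (forall x, I.1 < x < I.2 -> act w x = x \/ act h x = x) ->
  forall x, I.1 < x < I.2 -> act (w * h)%g x = act (h * w)%g x.
Proof.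
move=> Hw Hh gI dis x Ix; rewrite !(la_mul Hact) //.
have [wx|hx] := dis x Ix.
  rewrite wx; have [//|hhx] : act w (act h x) = act h x \/ act h (act h x) = act h x.
    by apply: dis; rewrite gap_act.
  by have := can_inj (la_invK Hact Hh) hhx => ->.
rewrite hx; have [wwx|//] : act w (act w x) = act w x \/ act h (act w x) = act w x.
  by apply: dis; rewrite gap_act.
by have := can_inj (la_invK Hact Hw) wwx => ->.
Qed.

(* Induction on the number of gaps: push the support of [w] off itself in one
   gap; then [w] and its conjugate commute there, so their commutator lives on
   fewer gaps. *)
Lemma near_trivial_eq1 (s : seq (R * R)) w : H w -> near_trivial w ->
  (forall I, List.In I s -> gap I) ->
  (forall x, act w x <> x -> exists2 I, List.In I s & I.1 < x < I.2) -> w = 1%g.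
Proof.
elim: s w => [|I s IHs] w Hw tw sg sw.
  by apply: act_faithful => // x; apply: contrapT => /sw[].
have gI : gap I by apply: sg; left.
have sg' J : List.In J s -> gap J by move=> Js; apply: sg; right.
suff wI : forall x, I.1 < x < I.2 -> act w x = x.
  apply: IHs => // x wx; have [J [<- /wI|Js xJ]] := sw x wx; last by exists J.
  by move/wx.
have [I12 f1 f2 _] := gI.
have [u1 [u [/andP[u1I u1u] wu]]] := tw _ f1.
have [v [v2 [/andP[vv2 v2v] wv]]] := tw _ f2.
(* In the gap [w] moves only points beyond [al] and up to [v]; the minimum with [I.2] keeps [al]
   inside the gap. *)
pose al := (I.1 + Num.min u I.2) / 2.
have alI : I.1 < al < I.2.
  have : I.1 < Num.min u I.2 by rewrite lt_min u1u.
  have : Num.min u I.2 <= I.2 by rewrite ge_min lexx orbT.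
  by move=> *; apply/andP; split; rewrite /al; lra.
have wal y : I.1 < y <= al -> act w y = y.
  move=> /andP[Iy yal]; apply: wu.
  have : I.1 < Num.min u I.2 by rewrite lt_min u1u.
  have : Num.min u I.2 <= u by rewrite ge_min lexx.
  by move=> *; rewrite /al in yal; apply/andP; split; lra.
(* Since [h] carries [al] past [v], the points of the gap moved by [w'] lie beyond [v], where [w] is
   trivial. *)
have [h Hh vh] := gap_push gI alI vv2.
pose w' := (h * w / h)%g.
have Hw' : H w'.
  by do 2?[apply: (la_subM Hact) => //]; exact: (la_subV Hact).
have dis y : I.1 < y < I.2 -> act w y = y \/ act w' y = y.
  move=> Iy; have [hy|hy] := leP (act h^-1%g y) al.
    right; rewrite /w' (la_conj Hact) // wal ?(la_Kinv Hact) // hy andbT.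
    have : I.1 < act h^-1%g y < I.2 by rewrite gap_act //; exact: (la_subV Hact).
    by case/andP.
  left; apply: wv; have /andP[_ yI] := Iy; apply/andP; split; last by lra.
  by apply: lt_trans vh _; rewrite -(la_Kinv Hact Hh y) (la_ltE Hact).
have outside y : ~ (exists2 J, List.In J (I :: s) & J.1 < y < J.2) ->
    act w y = y /\ act w' y = y.
  move=> ny; split; first by apply: contrapT => /sw.
  have why : act w (act h^-1%g y) = act h^-1%g y.
    apply: contrapT => /sw[J Js]; rewrite gap_act; last exact: (la_subV Hact).
      by move=> yJ; apply: ny; exists J.
    exact: sg.
  by rewrite /w' (la_conj Hact) // why (la_Kinv Hact).
have Hww : H (w * w')%g /\ H (w' * w)%g by split; apply: (la_subM Hact).
have Hc : H (w * w' / (w' * w))%g.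
  by apply: (la_subM Hact); [case: Hww|apply: (la_subV Hact); case: Hww].
have tw' : near_trivial w' by exact: near_trivialJ.
(* On [I] the two elements commute by disjointness, and off all listed gaps both are trivial, so the
   commutator moves only points of the gaps in [s]. *)
have c1 : (w * w' / (w' * w))%g = 1%g.
  apply: IHs => //.
    case: Hww => ? ?; apply: near_trivialM => //.
    - exact: (la_subV Hact).
    - exact: near_trivialM.
    - by apply: near_trivialV => //; exact: near_trivialM.
  move=> x cx; apply: contrapT => nx; apply: cx.
  have wwV : H (w' * w)^-1%g by case: Hww => _ /(la_subV Hact).
  rewrite (la_mul Hact) //; last by case: Hww.
  have -> : act (w * w')%g (act (w' * w)^-1%g x) =
            act (w' * w)%g (act (w' * w)^-1%g x).
    have [Iy|nIy] := pselect (I.1 < act (w' * w)^-1%g x < I.2).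
      exact: commute_disjoint Iy.
    have [] := outside (act (w' * w)^-1%g x).
      move=> [J [<-//|Js yJ]]; apply: nx; exists J => //.
      by move: yJ; rewrite gap_act //; exact: sg'.
    by move=> e1 e2; rewrite (la_mul Hact Hw Hw') (la_mul Hact Hw' Hw) e2 e1 e2.
  by apply: (la_Kinv Hact); case: Hww.
have cw : commute w w' by exact: divg1_eq c1.
have {}cw : commute w h by exact: conj_commute cw.
have ww' : w' = w by rewrite /w' -cw mulgK.
(* As [w'] equals [w], both alternatives of [dis] say that [w] fixes [x]. *)
by move=> x Ix; case: (dis x Ix) => //; rewrite ww'.
Qed.

End Gaps.

(** * Erasable words and disjoint supports *)

Section DisjointSupports.
Variables (R : realType) (G : groupType) (H : set G) (act : G -> R -> R).
Variables (l r : R).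
Hypothesis Hact : line_action H act.
Hypothesis act_out : forall g x, H g -> x <= l \/ r <= x -> act g x = x.
Hypothesis act_faithful : forall g, H g -> act g =1 id -> g = 1%g.
Hypothesis act_right_tame : forall g, H g -> right_tame (act g).
Hypothesis act_left_tame : forall g, H g -> left_tame (act g).
Hypothesis commute_trans : forall x y z : G,
  x <> 1%g -> commute x y -> commute x z -> commute y z.
Hypothesis conj_commute : forall w h : G,
  commute w (h * w / h)%g -> commute w h.

Lemma erasable_word_eq1 (rho : bool -> bool -> G) w :
  (forall s i, H (rho s i)) ->
  (forall s x, act (rho s true) x = x \/ act (rho s false) x = x) ->
  (forall s i, word_val (erase s i rho) w = 1%g) -> word_val rho w = 1%g.
Proof.
move=> Hrho dis erw.
(* [K] contains the letters, and its global fixed points are exactly their common fixed points, so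
   its gaps are those of the four letters. *)
pose K : set G := [set h | H h /\
  forall p, (forall s i, act (rho s i) p = p) -> act h p = p].
have Krho s i : K (rho s i) by split.
have Kact : line_action K act.
  split; [|exact: la_one Hact| |]; last first.
  - by move=> g [Hg _]; exact: (la_lt Hact).
  - by move=> g h [Hg _] [Hh _]; exact: (la_mul Hact).
  split.
  - by split; [exact: la_sub1 Hact|move=> p _; exact: la_one Hact _].
  - move=> g h [Hg gf] [Hh hf]; split; first exact: (la_subM Hact).
    by move=> p fp; rewrite (la_mul Hact) // hf // gf.
  - move=> g [Hg gf]; split; first exact: (la_subV Hact).
    by move=> p fp; apply: (la_fixV Hact) => //; exact: gf.
have Kw : K (word_val rho w) by exact: word_val_in Kact Krho w.
have Kout g x : K g -> x <= l \/ r <= x -> act g x = x.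
  by case=> Hg _; exact: act_out.
have tw : near_trivial K act (word_val rho w).
  move=> p fp; have rp s i : act (rho s i) p = p by exact: fp.
  have [e1 e10 He1] := trivial_on_right Hact Hrho dis act_right_tame rp erw.
  (* The left side of [p] is the right side of [- p] for the reflected action. *)
  have Hact' := line_action_reflected Hact.
  have dis' s x : reflected act (rho s true) x = x \/
                  reflected act (rho s false) x = x.
    by rewrite /reflected; case: (dis s (- x)) => ->; rewrite opprK; [left|right].
  have rp' s i : reflected act (rho s i) (- p) = - p.
    by rewrite /reflected opprK rp.
  have [e2 e20 He2] :=
    trivial_on_right Hact' Hrho dis' act_left_tame rp' erw.
  exists (p - e2), (p + e1); split; first by apply/andP; split; lra.
  move=> x /andP[x1 x2]; have [xp|px|->] := ltgtP x p.
  - have : - p < - x < - p + e2 by apply/andP; split; lra.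
    by move=> /He2; rewrite /reflected opprK => /oppr_inj.
  - by apply: He1; rewrite px.
  - by apply: (word_val_fix Hact).
have [s sg sw] := finite_gap_cover Kact Kout Kw tw.
apply: (near_trivial_eq1 Kact) sg sw => // g [Hg _].
exact: act_faithful.
Qed.

(* All erasures of [[a, b^t], z [b, a^t] z^-1] are trivial; if the word were
   trivial for z = 1, a and a^t, then a and a^t would commute. *)
Theorem disjoint_supports_commute (a b t : G) : H a -> H b -> H t ->
  (forall x, act a x = x \/ act b x = x) ->
  a <> 1%g -> b <> 1%g -> commute a t.
Proof.
move=> Ha Hb Ht dis a1 b1; apply: contrapT => ncat.
pose rho s i := let c := if i then a else b in if s then (t * c / t)%g else c.
have HJ g : H g -> H (t * g / t)%g.
  by move=> Hg; do 2?[apply: (la_subM Hact) => //]; exact: (la_subV Hact).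
have Hrho s i : H (rho s i) by rewrite /rho; case: s; case: i => //; exact: HJ.
have rdis s x : act (rho s true) x = x \/ act (rho s false) x = x.
  rewrite /rho; case: s => //; rewrite !(la_conj Hact) //.
  by case: (dis (act t^-1%g x)) => ->; rewrite (la_Kinv Hact) //; [left|right].
have cab : commute a b.
  have Hab : H (a * b)%g /\ H (b * a)%g by split; apply: (la_subM Hact).
  case: Hab => Hab Hba; apply: divg1_eq; apply: act_faithful.
    by apply: (la_subM Hact) => //; exact: (la_subV Hact).
  move=> x; have HVba := la_subV Hact Hba; rewrite (la_mul Hact) //.
  rewrite /= -[RHS](la_Kinv Hact Hba); set y := act _ x.
  rewrite !(la_mul Hact) //.
  have aK := can_inj (la_invK Hact Ha); have bK := can_inj (la_invK Hact Hb).
  case: (dis y) => [ay|By].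
    by rewrite ay; case: (dis (act b y)) => // /bK ->.
  by rewrite By; case: (dis (act a y)) => // /aK ->.
pose A0 := [:: (false, true, false)]; pose B0 := [:: (false, false, false)].
pose A1 := [:: (true, true, false)]; pose B1 := [:: (true, false, false)].
pose X := word_comm A0 B1; pose Y := word_comm B0 A1.
have vA0 : word_val rho A0 = a by rewrite /= mulg1.
have vB0 : word_val rho B0 = b by rewrite /= mulg1.
have vA1 : word_val rho A1 = (t * a / t)%g by rewrite /= mulg1.
have vB1 : word_val rho B1 = (t * b / t)%g by rewrite /= mulg1.
(* If [a] commuted with [t * b / t], transitivity through [a] would make [b] commute with its
   conjugate, hence with [t]; transitivity through [b] would then make [a] commute with [t]. *)
have X1 : word_val rho X <> 1%g.
  apply: word_val_comm_neq1; rewrite vA0 vB1 => c.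
  have /conj_commute cbt : commute b (t * b / t)%g by exact: commute_trans a1 cab c.
  exact: ncat (commute_trans b1 (commute_sym cab) cbt).
have Y1 : word_val rho Y <> 1%g.
  apply: word_val_comm_neq1; rewrite vB0 vA1 => c.
  have /conj_commute : commute a (t * a / t)%g.
    exact: commute_trans b1 (commute_sym cab) c.
  exact: ncat.
have W1 z : commute (word_val rho X) (word_val rho (z ++ Y ++ word_flip z)).
  apply: contrapT => /word_val_comm_neq1; apply.
  apply: erasable_word_eq1 => // s i; apply: word_val_comm1.
  set rho' := erase s i rho.
  have eX : (s == true) && (i == false) || (s == false) && (i == true) ->
      word_val rho' X = 1%g.
    by move=> si; apply: word_val_comm1; rewrite /rho' /= !mulg1 /letter_val /erase /=;
      case: s i si {rho'} => -[] //= _; [exact: commute1|exact/commute_sym/commute1].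
  have eY : (s == true) && (i == true) || (s == false) && (i == false) ->
      word_val rho' Y = 1%g.
    by move=> si; apply: word_val_comm1; rewrite /rho' /= !mulg1 /letter_val /erase /=;
      case: s i si {rho' eX} => -[] //= _; [exact: commute1|exact/commute_sym/commute1].
  have [si|nsi] := boolP ((s == true) && (i == false) || (s == false) && (i == true)).
    by rewrite eX //; exact/commute_sym/commute1.
  rewrite (word_val_cat _ z) (word_val_cat _ Y) word_val_flip eY.
    by rewrite mul1g mulgV; exact: commute1.
  by case: s i nsi {rho' eX eY} => -[].
(* [X] commutes with [Y] and with the conjugate of [Y] by [z], so these two commute with each other,
   and then [Y] commutes with [z]. *)
have cYz z : commute (word_val rho Y) (word_val rho z).
  apply: conj_commute; have := W1 z.
  rewrite (word_val_cat _ z) (word_val_cat _ Y) word_val_flip mulgA => c.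
  apply: commute_trans X1 _ c; have := W1 [::].
  by rewrite cats0.
(* [Y] commutes with both [a] and [t * a / t], which therefore commute. *)
apply: ncat; apply: conj_commute; rewrite -{1}vA0 -vA1.
exact: commute_trans Y1 (cYz A0) (cYz A1).
Qed.

End DisjointSupports.

(** * C^1 maps near accumulated fixed points *)

Section StrictDifferentiability.
Variable R : realType.
Implicit Types (f F : R -> R) (l r p x y : R).

(** By the mean value theorem and continuity of the derivative, the estimate is uniform in two
    points near [p]. *)
Lemma strict_derivative F p : C1_near F p -> forall eps, 0 < eps ->
  exists2 del, 0 < del & forall x y, `|x - p| < del -> `|y - p| < del ->
    `|F x - F y - derive1 F p * (x - y)| <= eps * `|x - y|.
Proof.
move=> CF eps e0; have [_ /cvgrPdist_lt/(_ _ e0) nF'] := nbhs_singleton CF.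
have [del /= d0 Hd] : nbhs_ball_ (ball_ Num.norm) p (fun z : R =>
    derivable F z 1 /\ `|derive1 F p - derive1 F z| < eps).
  by apply/nbhs_normP; apply: filterS2 CF nF' => z [].
exists del => //.
suff main x y : x < y -> `|x - p| < del -> `|y - p| < del ->
    `|F y - F x - derive1 F p * (y - x)| <= eps * `|y - x|.
  move=> x y xd yd; have [xy|yx|->] := ltgtP x y; last first.
  - by rewrite !subrr mulr0 subrr normr0 mulr0.
  - exact: main.
  - rewrite -normrN [`|x - y|]distrC.
    have -> : - (F x - F y - derive1 F p * (x - y)) =
      F y - F x - derive1 F p * (y - x) by ring.
    exact: main.
move=> xy xd yd.
have inb z : z \in `[x, y] -> derivable F z 1 /\ `|derive1 F p - derive1 F z| < eps.
  rewrite in_itv /= => /andP[xz zy]; apply: Hd => /=.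
  move: xd yd; rewrite !ltr_norml => /andP[? ?] /andP[? ?].
  by apply/andP; split; lra.
have [||c cxy ->] := @MVT R F (derive1 F) x y xy.
- move=> z zxy; have [dz _] := inb z (subset_itv_oo_cc zxy).
  by rewrite derive1E; exact: derivableP.
- by apply: derivable_within_continuous => z /inb[].
have [_ hc] := inb c (subset_itv_oo_cc cxy).
by rewrite -mulrBl normrM ler_wpM2r // distrC ltW.
Qed.

Lemma C1_near_continuous F p : C1_near F p -> forall eps, 0 < eps ->
  exists2 del, 0 < del & forall x, `|x - p| < del -> `|F x - F p| < eps.
Proof.
move=> CF eps e0; have [/derivable1_diffP/differentiable_continuous] := nbhs_singleton CF.
move=> /cvgrPdist_lt/(_ _ e0) /nbhs_normP[del /= d0 Hd] _.
by exists del => // x xd; rewrite distrC; apply: Hd; rewrite /= distrC.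
Qed.

Lemma C1_near_increasing F p : C1_near F p -> 0 < derive1 F p ->
  exists2 del, 0 < del & forall x y, `|x - p| < del -> `|y - p| < del ->
    x < y -> F x < F y.
Proof.
move=> CF d0; have e0 : 0 < derive1 F p / 2 by lra.
have [del del0 Hd] := strict_derivative CF e0; exists del => // x y xd yd xy.
have := Hd y x yd xd; rewrite [in X in _ <= X]gtr0_norm ?subr_gt0 // ler_norml.
move=> /andP[+ _]; have : 0 < derive1 F p * (y - x) by rewrite mulr_gt0 ?subr_gt0.
by rewrite mulrAC; lra.
Qed.

(* [F] is only a local extension of [f] up to a translation, so that circle
   maps can be treated with the lifts at hand. *)
Definition locally_C1_pos l r f : Prop := forall x, l <= x <= r ->
  exists F c, [/\ exists2 del, 0 < del &
    forall y, `|y - x| < del -> l <= y <= r -> f y = F y - c,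
    C1_near F x & 0 < derive1 F x].

Lemma locally_C1_increasing l r f x y : locally_C1_pos l r f ->
  l <= x -> x < y -> y <= r -> f x < f y.
Proof.
move=> Cf lx xy yr.
have loc z : l <= z <= r -> exists2 del, 0 < del & forall u v,
    `|u - z| < del -> `|v - z| < del -> l <= u -> u < v -> v <= r -> f u < f v.
  move=> /Cf[F [c [[d1 d10 fF] CF F0]]].
  have [d2 d20 incF] := C1_near_increasing CF F0.
  exists (Num.min d1 d2); first by rewrite lt_min d10.
  move=> u v; rewrite !lt_min => /andP[u1 u2] /andP[v1 v2] lu uv vr.
  rewrite !fF //; [|by apply/andP; split; lra..].
  by rewrite ltrD2r incF.
pose E := [set s | x <= s <= y /\ forall u, x < u -> u <= s -> f x < f u].
have Ex : E x by split=> [|u xu ux]; [rewrite lexx ltW|lra].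
have hE : has_sup E by split; [exists x | exists y => s [/andP[]]].
set c := sup E.
have xc : x <= c by exact: ub_le_sup hE.2 _ Ex.
have cy : c <= y by apply: ge_sup; [exists x | move=> s [/andP[]]].
have [|del d0 Hd] := loc c; first by apply/andP; split; lra.
have [s Es cs] := sup_adherent d0 hE; rewrite -/c in cs.
have sc : s <= c by exact: ub_le_sup hE.2 _ Es.
case: Es => /andP[xs sy] Es.
pose m := Num.min y (c + del / 2).
have my : m <= y by rewrite /m ge_min lexx.
have mc : m <= c + del / 2 by rewrite /m ge_min lexx orbT.
have Em u : x < u -> u <= m -> f x < f u.
  move=> xu um; have [us|su] := leP u s; first exact: Es.
  have fsu : f s < f u.
    by apply: Hd; rewrite ?ltr_norml; do ?[apply/andP; split]; lra.
  have [xs'|] := ltP x s; first by apply: lt_trans fsu; exact: Es.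
  by move=> sx; have -> : x = s by lra.
have xm : x <= m by rewrite /m le_min; apply/andP; split; lra.
have mc' : m <= c by apply: ub_le_sup hE.2 _ _; split=> //; rewrite xm.
apply: Em => //; move: mc'; rewrite /m; case: (leP y (c + del / 2)); lra.
Qed.

(** Between two fixed points the slope of [f] is 1, which puts the derivative at [p] within
    [eps / 2] of 1; strict differentiability accounts for the other half. The set [J] selects a side
    of [p]. *)
Lemma tame_near l r f p (J : set R) : locally_C1_pos l r f -> l <= p <= r ->
  J `<=` [set x | l <= x <= r] ->
  (forall eta, 0 < eta -> exists y1 y2, [/\ y1 < y2, J y1 /\ J y2,
     `|y1 - p| < eta, `|y2 - p| < eta & f y1 = y1 /\ f y2 = y2]) ->
  forall eps, 0 < eps -> exists2 del, 0 < del & forall x y, J x -> J y ->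
    `|x - p| < del -> `|y - p| < del ->
    `|(f x - x) - (f y - y)| <= eps * `|x - y|.
Proof.
move=> Cf pin Jlr acc eps e0; have [F [c [[d1 d10 fF] CF _]]] := Cf p pin.
have e20 : 0 < eps / 2 by lra.
have [d2 d20 HF] := strict_derivative CF e20.
pose del := Num.min d1 d2.
have del0 : 0 < del by rewrite lt_min d10.
have key x y : J x -> J y -> `|x - p| < del -> `|y - p| < del ->
    `|f x - f y - derive1 F p * (x - y)| <= eps / 2 * `|x - y|.
  move=> /Jlr xin /Jlr yin; rewrite !lt_min => /andP[x1 x2] /andP[y1 y2].
  rewrite !fF //; have -> : F x - c - (F y - c) = F x - F y by ring.
  exact: HF.
exists del => // x y Jx Jy xd yd.
have [y1 [y2 [y12 [Jy1 Jy2] y1d y2d [fy1 fy2]]]] := acc del del0.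
have D1 : `|1 - derive1 F p| <= eps / 2.
  have := key y2 y1 Jy2 Jy1 y2d y1d; rewrite fy1 fy2.
  have -> : y2 - y1 - derive1 F p * (y2 - y1) = (1 - derive1 F p) * (y2 - y1) by ring.
  by rewrite normrM ler_pM2r // normr_gt0 subr_eq0 gt_eqF.
have -> : (f x - x) - (f y - y) =
  (f x - f y - derive1 F p * (x - y)) - (1 - derive1 F p) * (x - y) by ring.
rewrite (le_trans (ler_normB _ _)) // normrM.
have := key x y Jx Jy xd yd; have := ler_wpM2r (normr_ge0 (x - y)) D1; lra.
Qed.

Section Extension.
Variables (l r : R) (f : R -> R).
Hypothesis lr : l < r.
Hypothesis f_out : forall x, x <= l \/ r <= x -> f x = x.
Hypothesis Cf : locally_C1_pos l r f.

Lemma extension_increasing x y : x < y -> f x < f y.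
Proof.
have fl : f l = l by apply: f_out; left.
have fr : f r = r by apply: f_out; right.
move=> xy.
have [xl|lx] := leP x l.
  rewrite (f_out (or_introl xl)).
  have [yl|ly] := leP y l; first by rewrite (f_out (or_introl yl)).
  have [ry|yr] := leP r y; first by rewrite (f_out (or_intror ry)).
  apply: le_lt_trans xl _; rewrite -[X in X < _]fl.
  exact: (locally_C1_increasing Cf) (lexx _) ly (ltW yr).
have [ry|yr] := leP r y.
  rewrite (f_out (or_intror ry)).
  have [rx|xr] := leP r x; first by rewrite (f_out (or_intror rx)).
  apply: lt_le_trans ry; rewrite -[X in _ < X]fr.
  exact: (locally_C1_increasing Cf) (ltW lx) xr (lexx _).
exact: (locally_C1_increasing Cf) (ltW lx) xy (ltW yr).
Qed.

Lemma extension_right_tame : right_tame f.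
Proof.
move=> p acc eps e0.
have trivial_case x y : f x = x -> f y = y ->
    `|(f x - x) - (f y - y)| <= eps * `|x - y|.
  by move=> -> ->; rewrite !subrr normr0 mulr_ge0 // ltW.
have [pl|lp] := ltP p l.
  exists (l - p); first by rewrite subr_gt0.
  move=> x y /andP[? ?] /andP[? ?].
  by apply: trivial_case; apply: f_out; left; lra.
have [rp|pr] := leP r p.
  exists 1 => // x y /andP[? ?] /andP[? ?].
  by apply: trivial_case; apply: f_out; right; lra.
have [|z|eta eta0|del d0 Hd] := @tame_near l r f p [set x | p < x <= r] Cf _ _ _ eps e0.
- by rewrite lp ltW.
- by move=> /= /andP[pz zr]; apply/andP; split; lra.
- have m0 : 0 < Num.min eta (r - p) by rewrite lt_min eta0 subr_gt0.
  have [y2 /andP[py2 y2e] fy2] := acc _ m0.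
  have y20 : 0 < y2 - p by rewrite subr_gt0.
  have [y1 /andP[py1 y1e] fy1] := acc _ y20.
  move: y2e; rewrite addr_minr lt_min => /andP[y2e y2r].
  exists y1, y2; rewrite !ltr_norml /=; split=> //.
  - by lra.
  - by split; apply/andP; split; lra.
  - by apply/andP; split; lra.
  - by apply/andP; split; lra.
exists (Num.min del (r - p)); first by rewrite lt_min d0 subr_gt0.
move=> x y /andP[px]; rewrite addr_minr lt_min => /andP[xd xr].
move=> /andP[py]; rewrite lt_min => /andP[yd yr].
by apply: Hd; rewrite /= ?ltr_norml; apply/andP; split; lra.
Qed.

Lemma extension_left_tame : left_tame f.
Proof.
move=> q acc eps e0; pose p := - q.
have qE : q = - p by rewrite opprK.
have trivial_case x y : f (- x) = - x -> f (- y) = - y ->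
    `|(- f (- x) - x) - (- f (- y) - y)| <= eps * `|x - y|.
  by move=> -> ->; rewrite !opprK !subrr normr0 mulr_ge0 // ltW.
have [rp|pr] := ltP r p.
  exists (p - r); first by rewrite subr_gt0.
  move=> x y /andP[? ?] /andP[? ?].
  by apply: trivial_case; apply: f_out; right; lra.
have [pl|lp] := leP p l.
  exists 1 => // x y /andP[? ?] /andP[? ?].
  by apply: trivial_case; apply: f_out; left; lra.
have [|z|eta eta0|del d0 Hd] := @tame_near l r f p [set x | l <= x < p] Cf _ _ _ eps e0.
- by rewrite pr ltW.
- by move=> /= /andP[lz zp]; apply/andP; split; lra.
- have m0 : 0 < Num.min eta (p - l) by rewrite lt_min eta0 subr_gt0.
  have [y2 /andP[py2 y2e] fy2] := acc _ m0.
  have y20 : 0 < y2 - q by rewrite subr_gt0.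
  have [y1 /andP[py1 y1e] fy1] := acc _ y20.
  move: y2e; rewrite addr_minr lt_min => /andP[y2e y2r].
  exists (- y2), (- y1); rewrite !ltr_norml /=; split.
  - by lra.
  - by split; apply/andP; split; lra.
  - by apply/andP; split; lra.
  - by apply/andP; split; lra.
  - by split; lra.
exists (Num.min del (p - l)); first by rewrite lt_min d0 subr_gt0.
move=> x y /andP[px]; rewrite addr_minr lt_min => /andP[xd xr].
move=> /andP[py]; rewrite lt_min => /andP[yd yr].
have := @Hd (- y) (- x); have -> : `|- y - - x| = `|x - y| by congr `|_|; ring.
have -> : f (- y) - - y - (f (- x) - - x) = - f (- x) - x - (- f (- y) - y) by ring.
by apply; rewrite /= ?ltr_norml; apply/andP; split; lra.
Qed.

End Extension.
End StrictDifferentiability.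

(** * Commutation in Z^2 * Z *)

Section Quaternions.
Variable A : comNzRingType.

(** The ring varies: words are evaluated over the integers, then reduced modulo 2 and modulo 5. *)
Record quat := Quat { q0 : A; q1 : A; q2 : A; q3 : A }.

Definition qzero := Quat 0 0 0 0.
Definition qone := Quat 1 0 0 0.
Definition qscale (c : A) (x : quat) :=
  Quat (c * q0 x) (c * q1 x) (c * q2 x) (c * q3 x).
Definition qconj (x : quat) := Quat (q0 x) (- q1 x) (- q2 x) (- q3 x).
Definition qsub (x y : quat) :=
  Quat (q0 x - q0 y) (q1 x - q1 y) (q2 x - q2 y) (q3 x - q3 y).
Definition qmul (x y : quat) := Quat
  (q0 x * q0 y - q1 x * q1 y - q2 x * q2 y - q3 x * q3 y)
  (q0 x * q1 y + q1 x * q0 y + q2 x * q3 y - q3 x * q2 y)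
  (q0 x * q2 y - q1 x * q3 y + q2 x * q0 y + q3 x * q1 y)
  (q0 x * q3 y + q1 x * q2 y - q2 x * q1 y + q3 x * q0 y).
Definition qnorm (x : quat) := q0 x ^+ 2 + q1 x ^+ 2 + q2 x ^+ 2 + q3 x ^+ 2.

Lemma qmulA x y z : qmul x (qmul y z) = qmul (qmul x y) z.
Proof. by case: x y z => ? ? ? ? [? ? ? ?] [? ? ? ?]; congr Quat => /=; ring. Qed.

Lemma qmul1 x : qmul qone x = x.
Proof. by case: x => ? ? ? ?; congr Quat => /=; ring. Qed.

Lemma qmulr1 x : qmul x qone = x.
Proof. by case: x => ? ? ? ?; congr Quat => /=; ring. Qed.

Lemma qmulr0 x : qmul x qzero = qzero.
Proof. by case: x => ? ? ? ?; congr Quat => /=; ring. Qed.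

Lemma qmul0 x : qmul qzero x = qzero.
Proof. by case: x => ? ? ? ?; congr Quat => /=; ring. Qed.

Lemma qscale0 x : qscale 0 x = qzero.
Proof. by case: x => ? ? ? ?; congr Quat => /=; ring. Qed.

Lemma qscaleA c d x : qscale c (qscale d x) = qscale (c * d) x.
Proof. by case: x => ? ? ? ?; congr Quat => /=; ring. Qed.

Lemma qscale1 x : qscale 1 x = x.
Proof. by case: x => ? ? ? ?; congr Quat => /=; ring. Qed.

Lemma qscaleAl c x y : qmul (qscale c x) y = qscale c (qmul x y).
Proof. by case: x y => ? ? ? ? [? ? ? ?]; congr Quat => /=; ring. Qed.

Lemma qscaleAr c x y : qmul x (qscale c y) = qscale c (qmul x y).
Proof. by case: x y => ? ? ? ? [? ? ? ?]; congr Quat => /=; ring. Qed.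

Lemma qconjK x : qconj (qconj x) = x.
Proof. by case: x => ? ? ? ?; rewrite /qconj /= !opprK. Qed.

Lemma qmul_conj x : qmul x (qconj x) = qscale (qnorm x) qone.
Proof. by case: x => ? ? ? ?; congr Quat; rewrite /qnorm /=; ring. Qed.

Lemma qconj_mul x : qmul (qconj x) x = qscale (qnorm x) qone.
Proof. by case: x => ? ? ? ?; congr Quat; rewrite /qnorm /=; ring. Qed.

Lemma qsub_mul x y z : qmul (qsub x y) z = qsub (qmul x z) (qmul y z).
Proof.
by case: x y z => ? ? ? ? [? ? ? ?] [? ? ? ?]; congr Quat => /=; ring.
Qed.

Lemma qnormM x y : qnorm (qmul x y) = qnorm x * qnorm y.
Proof. by case: x y => ? ? ? ? [? ? ? ?]; rewrite /qnorm /=; ring. Qed.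

Lemma qnormZ c x : qnorm (qscale c x) = c ^+ 2 * qnorm x.
Proof. by case: x => ? ? ? ?; rewrite /qnorm /=; ring. Qed.

(* 1 + 2i and 1 + 2j have norm 5, so they are zero divisors modulo 5. *)
Definition qgen (b : bool) := if b then Quat 1 2 0 0 else Quat 1 0 2 0.

Definition qexp (x : quat) (n : nat) := iter n (qmul x) qone.

(** Negative powers use the conjugate, which differs from the inverse by a norm factor, so that
    coefficients stay in the ring. *)
Definition qpow (x : quat) (z : int) :=
  match z with Posz n => qexp x n | Negz n => qexp (qconj x) n.+1 end.

Lemma qexpSr x n : qexp x n.+1 = qmul (qexp x n) x.
Proof.
elim: n => [|n IHn]; first by rewrite /= qmul1 qmulr1.
by rewrite [RHS]/= -qmulA -IHn.
Qed.

Lemma qpowN x z : qpow x (- z) = qpow (qconj x) z.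
Proof. by case: z => [[|n]|n] //=; rewrite qconjK. Qed.

(* The substitution b := a^N maps Z^2 * Z to the free group on 1 + 2i, 1 + 2j. *)
Definition qletter (N : nat) (l : Z2grp + Zgrp) : quat :=
  match l with
  | inl u => qpow (qgen true) ((u.1 : int) + N%:Z * (u.2 : int))
  | inr k => qpow (qgen false) (k : int)
  end.

Definition qword N (w : seq (Z2grp + Zgrp)) :=
  foldr (fun l => qmul (qletter N l)) qone w.

Lemma qword_cat N u v : qword N (u ++ v) = qmul (qword N u) (qword N v).
Proof. by elim: u => [|l u IHu] /=; rewrite ?qmul1 // IHu qmulA. Qed.

End Quaternions.

Lemma qscale_eq0 (F : fieldType) (c : F) x :
  c != 0 -> qscale c x = qzero F -> x = qzero F.
Proof.
move=> c0; case: x => x0 x1 x2 x3 [].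
rewrite -{1 2 3 4}(mulr0 c).
by move=> /(mulfI c0) -> /(mulfI c0) -> /(mulfI c0) -> /(mulfI c0) ->.
Qed.

Section QuaternionMap.
Variables (A B : comNzRingType) (f : {rmorphism A -> B}).

Definition qmap (x : quat A) : quat B :=
  Quat (f (q0 x)) (f (q1 x)) (f (q2 x)) (f (q3 x)).

Lemma qmapM x y : qmap (qmul x y) = qmul (qmap x) (qmap y).
Proof.
by rewrite /qmap /qmul /= !(rmorphB, rmorphD, rmorphM).
Qed.

Lemma qmap1 : qmap (qone A) = qone B.
Proof. by rewrite /qmap /qone /= !rmorph0 rmorph1. Qed.

Lemma qmap_pow x z : qmap (qpow x z) = qpow (qmap x) z.
Proof.
have qexpE y n : qmap (qexp y n) = qexp (qmap y) n.
  by elim: n => [|n IHn]; [exact: qmap1|rewrite /= qmapM IHn].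
by case: z => n; rewrite /qpow qexpE // /qmap /qconj /= !rmorphN.
Qed.

Lemma qmap_word N w : qmap (qword A N w) = qword B N w.
Proof.
have gen b : qmap (qgen A b) = qgen B b.
  by case: b; rewrite /qmap /= !rmorph0 rmorph1 rmorph_nat.
elim: w => [|l w IHw]; first exact: qmap1.
by rewrite /= qmapM IHw; case: l => k; rewrite /qletter qmap_pow gen.
Qed.

End QuaternionMap.

Section ReducedWords.
Local Open Scope group_scope.
Variables A B : groupType.
Implicit Types (l : A + B) (w : seq (A + B)).

Definition left_letter l : bool := if l is inl _ then true else false.
Definition letter_nontriv l : bool :=
  match l with inl a => a != 1 | inr b => b != 1 end.
Definition reduced w : bool :=
  all letter_nontriv w && sorted (fun l l' => left_letter l != left_letter l') w.

Lemma reducedP w : exists2 w', reduced w' & fp_eq w w'.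
Proof.
elim: w => [|l w [w' rw' ww']]; first by exists [::] => //; exact: fp_refl.
have lww' : fp_eq (l :: w) (l :: w') by exact: (fp_cat (fp_refl [:: l]) ww').
have [triv|nontriv] := boolP (~~ letter_nontriv l).
  exists w' => //; apply: fp_trans lww' _; apply: (@fp_cat _ _ [:: l] [::] w' w').
    by case: l triv => k; rewrite negbK => /eqP ->;
      [exact: fp_oneL|exact: fp_oneR].
  exact: fp_refl.
rewrite negbK in nontriv.
case: w' rw' ww' lww' => [|l' w'] rw' ww' lww'.
  by exists [:: l] => //; rewrite /reduced /= nontriv.
have [same|diff] := eqVneq (left_letter l) (left_letter l'); last first.
  by exists [:: l, l' & w'] => //; move: rw'; rewrite /reduced /= nontriv diff.
have [p [pl' pE]] : exists p, left_letter p = left_letter l' /\ fp_eq [:: l; l'] [:: p].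
  case: l l' same {nontriv rw' ww' lww'} => k [] k' //= _.
    by exists (inl (k * k')); split=> //; exact: fp_mulL.
  by exists (inr (k * k')); split=> //; exact: fp_mulR.
have {}lww' : fp_eq (l :: w) (p :: w').
  by apply: fp_trans lww' _; exact: (fp_cat pE (fp_refl w')).
move: rw'; rewrite /reduced /= => /andP[/andP[_ ntw'] sw'].
have sw := path_sorted sw'.
have [triv|] := boolP (~~ letter_nontriv p).
  exists w'; first by rewrite ntw'.
  apply: fp_trans lww' _; apply: (@fp_cat _ _ [:: p] [::] w' w').
    by case: p triv {pE pl'} => k; rewrite negbK => /eqP ->;
      [exact: fp_oneL|exact: fp_oneR].
  exact: fp_refl.
rewrite negbK => pnt; exists (p :: w') => //=; rewrite pnt ntw' /=.
by case: w' {ntw' ww' lww' sw} sw' => //= l'' w'' /andP[? ->]; rewrite pl' andbT.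
Qed.

End ReducedWords.

Section QuaternionVectors.
Implicit Types x y z : quat int.

Definition qscalar x := [/\ q1 x = 0, q2 x = 0 & q3 x = 0].

(** This is the vanishing of the cross product of the imaginary parts. *)
Definition qparallel x y := [/\ q2 x * q3 y = q3 x * q2 y,
  q3 x * q1 y = q1 x * q3 y & q1 x * q2 y = q2 x * q1 y].

Lemma qmulC_parallel x y : qmul x y = qmul y x <-> qparallel x y.
Proof.
case: x y => a0 a1 a2 a3 [b0 b1 b2 b3]; rewrite /qparallel /qmul /=; split.
  by case=> _ h1 h2 h3; split; lia.
by case=> h1 h2 h3; congr Quat; lia.
Qed.

Lemma qparallel_trans x y z : ~ qscalar x ->
  qparallel x y -> qparallel x z -> qparallel y z.
Proof.
case: x y z => a0 a1 a2 a3 [b0 b1 b2 b3] [c0 c1 c2 c3].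
rewrite /qscalar /qparallel /= => ns [h1 h2 h3] [k1 k2 k3].
(* A nonzero coordinate [a] of the first vector expresses the other two as rational multiples of it;
   multiplying by [a * a] clears denominators. *)
have pivot (a ai aj bk bi bj ck ci cj : int) : a != 0 ->
    a * bi = ai * bk -> a * bj = aj * bk -> a * ci = ai * ck -> a * cj = aj * ck ->
    bi * cj = bj * ci.
  move=> n0 e1 e2 e3 e4; apply: (mulfI (mulf_neq0 n0 n0)).
  by rewrite mulrACA e1 e4 [RHS]mulrACA e2 e3; ring.
have [a10|n1] := eqVneq a1 0; last first.
  by split; [apply: (pivot a1 a2 a3 b1 b2 b3 c1)|
    apply: (pivot a1 a3 a1 b1 b3 b1 c1)|
    apply: (pivot a1 a1 a2 b1 b1 b2 c1)].
have [a20|n2] := eqVneq a2 0; last first.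
  by split; [apply: (pivot a2 a2 a3 b2 b2 b3 c2)|
    apply: (pivot a2 a3 a1 b2 b3 b1 c2)|
    apply: (pivot a2 a1 a2 b2 b1 b2 c2)].
have [a30|n3] := eqVneq a3 0; last first.
  by split; [apply: (pivot a3 a2 a3 b3 b2 b3 c3)|
    apply: (pivot a3 a3 a1 b3 b3 b1 c3)|
    apply: (pivot a3 a1 a2 b3 b1 b2 c3)].
by case: ns.
Qed.

Lemma qparallel_scale x y : q0 x = 0 -> q0 y = 0 -> qparallel x y ->
  qscale (qnorm x) y = qscale (q1 y * q1 x + q2 y * q2 x + q3 y * q3 x) x.
Proof.
case: x y => b0 b1 b2 b3 [c0 c1 c2 c3]; rewrite /qparallel /qscale /qnorm /=.
move=> -> -> [e1 e2 e3]; congr Quat; first by ring.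
- have -> : (0 ^+ 2 + b1 ^+ 2 + b2 ^+ 2 + b3 ^+ 2) * c1 =
    b1 * b1 * c1 + b2 * (b2 * c1) + b3 * (b3 * c1) by ring.
  by rewrite -e3 e2; ring.
- have -> : (0 ^+ 2 + b1 ^+ 2 + b2 ^+ 2 + b3 ^+ 2) * c2 =
    b2 * b2 * c2 + b1 * (b1 * c2) + b3 * (b3 * c2) by ring.
  by rewrite e3 -e1; ring.
- have -> : (0 ^+ 2 + b1 ^+ 2 + b2 ^+ 2 + b3 ^+ 2) * c3 =
    b3 * b3 * c3 + b1 * (b1 * c3) + b2 * (b2 * c3) by ring.
  by rewrite -e2 e1; ring.
Qed.

(** Conjugation by [h] rotates imaginary parts, up to the factor [qnorm h]. If the image [u] of [v]
    stays on the line of [v], it is [v] up to this factor and a sign. The positive sign means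
    commutation; the negative one is a half-turn, which requires [h] to have real part 0. *)
Lemma qconjugate_commute h x : q0 h <> 0 -> ~ qscalar x ->
  let x' := qmul (qmul h x) (qconj h) in
  qmul x x' = qmul x' x -> qmul x h = qmul h x.
Proof.
move=> h0 nsx x' /qmulC_parallel px.
pose v := Quat 0 (q1 x) (q2 x) (q3 x).
pose u := qmul (qmul h v) (qconj h).
have pv : qparallel v u.
  move: px; rewrite /u /v /x'; case: (h) (x) => a0 a1 a2 a3 [b0 b1 b2 b3].
  by rewrite /qparallel /=; case=> e1 e2 e3; split; [move: e1|move: e2|move: e3] => e;
    apply/eqP; rewrite -subr_eq0; apply/eqP; move/eqP: e; rewrite -subr_eq0 => /eqP e;
    rewrite -[RHS]e; ring.
have u0 : q0 u = 0 by rewrite /u /v /=; ring.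
have nv : qnorm v != 0.
  apply: contra_notN nsx; rewrite /qnorm /qscalar /= => /eqP n0.
  by split; apply/eqP; rewrite -sqrf_eq0; apply/eqP; nia.
have nu : qnorm u = qnorm h ^+ 2 * qnorm v.
  by rewrite /u !qnormM; rewrite /qnorm /=; ring.
pose d := q1 u * q1 v + q2 u * q2 v + q3 u * q3 v.
have uE : qscale (qnorm v) u = qscale d v by exact: qparallel_scale.
have dE : (d - qnorm h * qnorm v) * (d + qnorm h * qnorm v) = 0.
  have := congr1 (@qnorm _) uE; rewrite !qnormZ nu => e.
  apply: (mulfI nv); rewrite mulr0.
  have -> : qnorm v * ((d - qnorm h * qnorm v) * (d + qnorm h * qnorm v)) =
    d ^+ 2 * qnorm v - qnorm v ^+ 2 * (qnorm h ^+ 2 * qnorm v) by ring.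
  by rewrite e subrr.
have nh : qnorm h != 0.
  apply/eqP; rewrite /qnorm => nh; apply: h0.
  by apply/eqP; rewrite -sqrf_eq0; apply/eqP; nia.
have uh : qmul u h = qscale (qnorm h) (qmul h v).
  by rewrite /u -qmulA qconj_mul qscaleAr qmulr1.
have key e : d = e * (qnorm h * qnorm v) -> qmul h v = qscale e (qmul v h).
  move=> de; have : qscale (qnorm v * qnorm h) (qmul h v) =
      qscale (qnorm v * qnorm h) (qscale e (qmul v h)).
    rewrite -[LHS]qscaleA -uh -qscaleAl uE qscaleAl de qscaleA.
    by congr qscale; ring.
  have nn : qnorm v * qnorm h != 0 by exact: mulf_neq0.
  case: (qmul h v) (qscale e (qmul v h)) => ? ? ? ? [? ? ? ?].
  by case=> /(mulfI nn) -> /(mulfI nn) -> /(mulfI nn) -> /(mulfI nn) ->.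
have [/eqP|/eqP] : d - qnorm h * qnorm v = 0 \/ d + qnorm h * qnorm v = 0.
- by move/eqP: dE; rewrite mulf_eq0 => /orP[]/eqP ->; [left|right].
- rewrite subr_eq0 => /eqP de; have := key 1; rewrite mul1r => /(_ de).
  rewrite qscale1 => /qmulC_parallel; rewrite /qparallel /v /= => -[e1 e2 e3].
  by apply/qmulC_parallel; split; rewrite ?e1 ?e2 ?e3 //; lia.
(* Here [h] and [v] anticommute, and the imaginary part of this relation makes [q0 h] times each
   coordinate of [v] zero. *)
- rewrite addr_eq0 => /eqP de; have := key (-1); rewrite mulN1r => /(_ de).
  rewrite /qmul /qscale /v /= => -[_ e1 e2 e3].
  case: nsx; split; apply: (mulfI (introN eqP h0)); lia.
Qed.

End QuaternionVectors.

(** * Words as quaternions up to a positive factor *)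

Section QuaternionSimilarity.
Implicit Types x y z : quat int.

(** Equality up to a positive rational factor, which absorbs the norms created by conjugates
    standing for inverses. *)
Definition qsim x y := exists m n : int,
  [/\ 0 < m, 0 < n & qscale m x = qscale n y].

Lemma qsim_refl x : qsim x x.
Proof. by exists 1, 1. Qed.

Lemma qsim_sym x y : qsim x y -> qsim y x.
Proof. by case=> m [n [m0 n0 e]]; exists n, m. Qed.

Lemma qsim_trans x y z : qsim x y -> qsim y z -> qsim x z.
Proof.
case=> m [n [m0 n0 e]] [m' [n' [m0' n0' e']]].
exists (m' * m), (n * n'); split; rewrite ?mulr_gt0 //.
by rewrite -qscaleA e qscaleA mulrC -qscaleA e' qscaleA.
Qed.

Lemma qsim_mul x x' y y' : qsim x x' -> qsim y y' -> qsim (qmul x y) (qmul x' y').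
Proof.
case=> m [n [m0 n0 e]] [m' [n' [m0' n0' e']]].
exists (m * m'), (n * n'); split; rewrite ?mulr_gt0 //.
by rewrite -qscaleA -qscaleAr -qscaleAl e e' qscaleAl qscaleAr qscaleA.
Qed.

Lemma qpow_succ x (z : int) : 0 < qnorm x -> qsim (qmul (qpow x z) x) (qpow x (z + 1)).
Proof.
move=> nx; case: z => n.
  by rewrite -PoszD addn1 /qpow qexpSr; exact: qsim_refl.
exists 1, (qnorm x); split=> //.
have -> : Negz n + 1 = - n%:Z by rewrite NegzE; lia.
rewrite qpowN /qpow qscale1 qexpSr -qmulA qconj_mul qscaleAr.
by rewrite qmulr1.
Qed.

Lemma qpowD x (y z : int) : 0 < qnorm x ->
  qsim (qmul (qpow x y) (qpow x z)) (qpow x (y + z)).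
Proof.
have pos (n : nat) x' (y' : int) : 0 < qnorm x' ->
    qsim (qmul (qpow x' y') (qpow x' n%:Z)) (qpow x' (y' + n%:Z)).
  move=> nx; elim: n => [|n IHn]; first by rewrite /= qmulr1 addr0; exact: qsim_refl.
  rewrite /qpow -/(qpow x' y') qexpSr qmulA -addn1 PoszD addrA.
  apply: qsim_trans (qpow_succ _ nx); apply: qsim_mul (qsim_refl _).
  exact: IHn.
move=> nx; case: z => n; first exact: pos.
have nx' : 0 < qnorm (qconj x) by move: nx; rewrite /qnorm /= !sqrrN.
have := pos n.+1 _ (- y) nx'.
by rewrite -!qpowN opprK NegzE opprD opprK.
Qed.

Lemma qnorm_gen b : 0 < qnorm (qgen int b).
Proof. by case: b. Qed.

Lemma qword_fp_eq N u v : fp_eq u v -> qsim (qword int N u) (qword int N v).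
Proof.
elim=> {u v} [u|u v _|u v w _ uv _ vw|u u' v v' _ uu' _ vv'| | |a a'|k k'].
- exact: qsim_refl.
- exact: qsim_sym.
- exact: qsim_trans uv vw.
- by rewrite !qword_cat; exact: qsim_mul.
- have -> : qword int N [:: inl 1%g] = qone int; last exact: qsim_refl.
  change (qmul (qpow (qgen int true) (0 + N%:Z * 0)) (qone int) = qone int).
  by rewrite mulr0 qmulr1.
- by rewrite /= qmulr1; exact: qsim_refl.
- pose e (u : Z2grp) : int := (u.1 : int) + N%:Z * (u.2 : int).
  have eM : e (a * a')%g = e a + e a' by rewrite /e addrACA -mulrDr.
  rewrite /qword /= !qmulr1 -/(e a) -/(e a') -/(e (a * a')%g) eM.
  exact: qpowD (qnorm_gen true).
- by rewrite /qword /= !qmulr1; exact: qpowD (qnorm_gen false).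
Qed.

(* Both letters are congruent to 1 modulo 2. *)
Lemma qword_q0_neq0 N w : q0 (qword int N w) <> 0.
Proof.
have pow1 (z : int) : qpow (qone 'F_2) z = qone 'F_2.
  have e n : qexp (qone 'F_2) n = qone 'F_2 by elim: n => //= n ->; rewrite qmul1.
  by case: z => n; rewrite /qpow ?e // (_ : qconj _ = qone _) ?e // /qconj /= oppr0.
have gen1 b : qgen 'F_2 b = qone 'F_2.
  by case: b; congr Quat; apply/val_inj.
have word1 : qword 'F_2 N w = qone 'F_2.
  by elim: w => //= l w ->; rewrite qmulr1; case: l => k; rewrite /qletter gen1 pow1.
move=> q00; have := congr1 (@q0 _) (qmap_word (intmul 1 : {rmorphism int -> 'F_2}) N w).
by rewrite word1 /= q00 => /eqP.
Qed.

Lemma qword_norm_gt0 N w : 0 < qnorm (qword int N w).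
Proof.
have := @qword_q0_neq0 N w; case: (qword _ _ _) => a b c d /= /eqP a0.
have : 0 < a ^+ 2 by rewrite exprn_even_gt0.
have := sqr_ge0 b; have := sqr_ge0 c; have := sqr_ge0 d.
rewrite /qnorm /=; lia.
Qed.

End QuaternionSimilarity.

(** * Ping-pong modulo 5 *)

Section ModFive.

Local Notation F := 'F_5.

Definition qsigned (b s : bool) := if s then qgen F b else qconj (qgen F b).

(** Modulo 5 a letter is killed by its conjugate, so this annihilator records the first letter of a
    nonzero product. *)
Definition qstarts (b s : bool) (x : quat F) :=
  qmul (qconj (qsigned b s)) x = qzero F /\ x <> qzero F.

Lemma qsigned_norm0 b s : qmul (qconj (qsigned b s)) (qsigned b s) = qzero F.
Proof.
rewrite qconj_mul -(qscale0 (qone F)); congr qscale.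
by case: b s => -[]; apply/val_inj.
Qed.

(* If two letters kill x on the left, so does the norm of their difference, which
   is a unit modulo 5. *)
Lemma qstarts_mul b s b' s' x : (b', s') != (b, ~~ s) -> qstarts b s x ->
  qstarts b' s' (qmul (qsigned b' s') x).
Proof.
move=> ne [x0 xn0]; split.
  by rewrite qmulA qsigned_norm0 qmul0.
move=> x0'; apply: xn0.
pose y := qsub (qsigned b' s') (qconj (qsigned b s)).
have yx : qmul y x = qzero F by rewrite qsub_mul x0 x0' /qsub /= subrr.
have : qmul (qconj y) (qmul y x) = qzero F by rewrite yx qmulr0.
rewrite qmulA qconj_mul qscaleAl qmul1; apply: qscale_eq0.
rewrite /y; apply/negP.
by case: b s b' s' ne {x0 x0' y yx} => -[] [] [] // _ /eqP/(congr1 val).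
Qed.

Lemma qstarts_exp b s n x : (x = qone F \/ exists s', qstarts (~~ b) s' x) ->
  qstarts b s (qmul (qexp (qsigned b s) n.+1) x).
Proof.
move=> hx; elim: n => [|n IHn]; last first.
  rewrite [qexp _ _]/= -qmulA; apply: (@qstarts_mul b s) => //.
  by case: (b) (s) => -[].
rewrite /= qmulr1; case: hx => [->|[s' hx]]; last first.
  by apply: qstarts_mul hx; case: (b) (s) (s') => -[] [].
rewrite qmulr1; split; first exact: qsigned_norm0.
by move/(congr1 (@q0 _)); case: b s => -[] /eqP.
Qed.

Definition nontrivial_at (N : nat) (l : Z2grp + Zgrp) : bool :=
  match l with
  | inl u => (u.1 : int) + N%:Z * (u.2 : int) != 0
  | inr k => (k : int) != 0
  end.

Lemma qstarts_word N l w : all (nontrivial_at N) (l :: w) ->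
  sorted (fun l l' => left_letter l != left_letter l') (l :: w) ->
  exists s, qstarts (left_letter l) s (qword F N (l :: w)).
Proof.
have step k v : nontrivial_at N k ->
    (qword F N v = qone F \/ exists s', qstarts (~~ left_letter k) s' (qword F N v)) ->
    exists s, qstarts (left_letter k) s (qword F N (k :: v)).
  move=> ntk hv; rewrite /qword /= -/(qword F N v).
  have [s [n ->]] : exists s n, qletter F N k = qexp (qsigned (left_letter k) s) n.+1.
    case: k ntk {hv} => [u|k] /=; [set z := (_ + _)|move: k => z];
      by case: z => [[|n]|n] // _; [exists true, n|exists false, n].
  by exists s; exact: qstarts_exp.
elim: w l => [|l' w IHw] l.
  by move=> /andP[ntl _] _; apply: step ntl _; left.
move=> /andP[ntl ntw] /andP[ll' sw]; apply: step ntl _; right.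
have -> : ~~ left_letter l = left_letter l'.
  by move: ll'; case: (left_letter l); case: (left_letter l').
exact: IHw ntw sw.
Qed.

(** A scalar [c] killed by a conjugate letter, whose real part is 1, must be 0, against the
    nonvanishing in [qstarts]. *)
Lemma qword_nonscalar N w : w <> [::] -> all (nontrivial_at N) w ->
  sorted (fun l l' => left_letter l != left_letter l') w -> ~ qscalar (qword int N w).
Proof.
case: w => // l w _ ntw sw; have [s [ss0 sn0]] := qstarts_word ntw sw.
move=> [e1 e2 e3].
have E := qmap_word (intmul 1 : {rmorphism int -> F}) N (l :: w).
set c : F := (q0 (qword int N (l :: w)))%:~R.
have {}E : qword F N (l :: w) = qscale c (qone F).
  by rewrite -E /qmap e1 e2 e3 /= /qscale /= mulr1 !mulr0.
apply: sn0; rewrite E -(qscale0 (qone F)); congr qscale.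
move: ss0; rewrite E qscaleAr qmulr1 => /(congr1 (@q0 _)) /=.
by case: (left_letter l) s => -[]; rewrite /= mulr1.
Qed.

End ModFive.

Lemma nontrivial_at_large (w : seq (Z2grp + Zgrp)) :
  all (@letter_nontriv Z2grp Zgrp) w ->
  exists M, forall N, (M <= N)%N -> all (nontrivial_at N) w.
Proof.
elim: w => [|l w IHw] /=; first by exists 0%N.
move=> /andP[ntl /IHw[M HM]].
have [M' HM'] : exists M', forall N, (M' <= N)%N -> nontrivial_at N l.
  case: l ntl => [[m n]|k] /= ntl; last by exists 0%N.
  (* If [m + N * n = 0] with [N] larger than the absolute value of [m], then [n = 0], hence
     [m = 0]. *)
  exists (`|(m : int)|.+1)%N => N mN; apply/eqP => e; move/eqP: ntl; apply.
  have n0 : n = 0 :> int by nia.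
  have m0 : m = 0 :> int by nia.
  by rewrite n0 m0.
exists (maxn M M') => N; rewrite geq_max => /andP[MN M'N].
by rewrite HM' ?HM.
Qed.

(** * Commutation and generation in the free product *)

Section FreeProductCommutation.
Local Open Scope group_scope.
Implicit Types x y z w h : Z2_free_Z.

Local Notation Q N x := (qword int N (fp_repr x)).

Lemma qscale_inj (c : int) : (0 < c)%R -> injective (qscale c).
Proof.
move=> c0 [x0 x1 x2 x3] [y0 y1 y2 y3].
have n0 : (c != 0)%R by rewrite gt_eqF.
by case=> /(mulfI n0) -> /(mulfI n0) -> /(mulfI n0) -> /(mulfI n0) ->.
Qed.

Lemma qsim_scalar (p q : quat int) : qsim p q -> qscalar p -> qscalar q.
Proof.
case=> m [n [_ n0 e]] [p1 p2 p3]; have n0' : (n != 0)%R by rewrite gt_eqF.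
by move: e; rewrite /qscale p1 p2 p3 mulr0 => -[_ e1 e2 e3];
  split; apply: (mulfI n0'); rewrite mulr0.
Qed.

Lemma qsim_commute (p q r : quat int) : qsim p q ->
  qmul r p = qmul p r -> qmul r q = qmul q r.
Proof.
case=> m [n [_ n0 e]] c; apply: (qscale_inj n0).
by rewrite -qscaleAr -qscaleAl -e qscaleAr qscaleAl c.
Qed.

(** Holding for all large [N], such statements about several elements can be combined at one common
    [N]. *)
Lemma qword_nonscalar_large x : x <> 1 ->
  exists M, forall N, (M <= N)%N -> ~ qscalar (Q N x).
Proof.
move=> x1; have [w /andP[ntw sw] xw] := reducedP (fp_repr x).
have wn : w <> [::].
  by move=> w0; apply: x1; rewrite -(fp_reprK x); apply/fp_classP; rewrite w0 in xw.
have [M HM] := nontrivial_at_large ntw; exists M => N MN sQ.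
apply: (qword_nonscalar wn (HM N MN) sw).
exact: qsim_scalar (qword_fp_eq N xw) sQ.
Qed.

Lemma qword_mul N x y : qsim (Q N (x * y)) (qmul (Q N x) (Q N y)).
Proof. by rewrite -qword_cat; apply/qword_fp_eq/fp_repr_class. Qed.

(** The two factors of the similarity agree, because both products have the same positive norm. *)
Lemma qword_commute N x y : commute x y ->
  qmul (Q N x) (Q N y) = qmul (Q N y) (Q N x).
Proof.
move=> cxy; have : qsim (qmul (Q N x) (Q N y)) (qmul (Q N y) (Q N x)).
  apply: qsim_trans (qsim_sym (qword_mul N x y)) _.
  by rewrite cxy; exact: qword_mul.
case=> m [n [m0 n0 e]].
have nxy : (0 < qnorm (Q N x) * qnorm (Q N y))%R.
  by rewrite mulr_gt0 ?qword_norm_gt0.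
have := congr1 (@qnorm _) e; rewrite !qnormZ !qnormM [X in (_ = _ * X)%R]mulrC.
move=> /(mulIf (lt0r_neq0 nxy)) /eqP; rewrite eqrXn2 ?ltW // => /eqP mn.
by move: e; rewrite mn => /(qscale_inj n0).
Qed.

(** The commutator is nontrivial, hence nonscalar for large [N], whereas commuting images would make
    its image similar to 1. *)
Lemma qword_ncommute x y : ~ commute x y -> exists M, forall N, (M <= N)%N ->
  qmul (Q N x) (Q N y) <> qmul (Q N y) (Q N x).
Proof.
move=> ncxy; pose c := x * y / (y * x).
have c1 : c <> 1 by move=> /divg1_eq.
have [M HM] := qword_nonscalar_large c1; exists M => N /HM nsc qc; apply: nsc.
pose z := y * x; have [m [n [m0 n0 e]]] : qsim (qmul (Q N c) (Q N z)) (Q N z).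
  apply: qsim_trans (qsim_sym (qword_mul N c z)) _.
  rewrite /c /z mulgVK; apply: qsim_trans (qword_mul N x y) _.
  by rewrite qc; apply/qsim_sym/qword_mul.
have nz := qword_norm_gt0 N (fp_repr z).
have : qsim (qone int) (Q N c).
  exists (n * qnorm (Q N z))%R, (m * qnorm (Q N z))%R.
  split; rewrite ?mulr_gt0 // -qscaleA -qmul_conj -qscaleAl -e.
  by rewrite qscaleAl -qmulA qmul_conj qscaleAr qmulr1 qscaleA.
by move=> /qsim_scalar; apply; split.
Qed.

(** For large [N] commutation is read off as proportionality of imaginary parts, which is transitive
    through a nonzero one. *)
Lemma Z2_free_Z_commute_trans x y z :
  x <> 1 -> commute x y -> commute x z -> commute y z.
Proof.
move=> /qword_nonscalar_large[M HM] cxy cxz.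
apply: contrapT => /qword_ncommute[M' HM'].
apply: (HM' _ (leq_maxr M M')); apply/qmulC_parallel.
apply: qparallel_trans (HM _ (leq_maxl M M')) _ _;
  by apply/qmulC_parallel; exact: qword_commute.
Qed.

(** The image of [h * w / h] is similar to the product of the images of [h] and [w] and the
    conjugate of that of [h], so [qconjugate_commute] applies. *)
Lemma Z2_free_Z_conj_commute w h : commute w (h * w / h) -> commute w h.
Proof.
move=> cw; have [->|/eqP w1] := eqVneq w 1; first exact/commute_sym/commute1.
have [M HM] := qword_nonscalar_large w1.
apply: contrapT => /qword_ncommute[M' HM'].
apply: (HM' _ (leq_maxr M M')); set N := maxn M M'.
apply: qconjugate_commute; [exact: qword_q0_neq0|exact: HM (leq_maxl _ _)|].
apply: qsim_commute (qword_commute N cw).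
have nh := qword_norm_gt0 N (fp_repr h).
have [m [n [m0 n0 e]]] : qsim (qmul (Q N (h * w / h)) (Q N h)) (qmul (Q N h) (Q N w)).
  apply: qsim_trans (qsim_sym (qword_mul _ _ _)) _.
  by rewrite mulgVK; exact: qword_mul.
exists (m * qnorm (Q N h))%R, n; split; rewrite ?mulr_gt0 //.
by rewrite -qscaleAl -e qscaleAl -qmulA qmul_conj qscaleAr qmulr1 qscaleA.
Qed.

Lemma Z2_free_Z_not_abelian : exists x y, ~ commute x y.
Proof.
pose u : seq (Z2grp + Zgrp) := [:: inl ((1 : int)%R, (0 : int)%R)].
pose v : seq (Z2grp + Zgrp) := [:: inr (1 : int)%R].
exists (fp_class u), (fp_class v) => cuv.
have : fp_class (u ++ v) = fp_class (v ++ u) by rewrite -!fp_mul_class; exact: cuv.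
move=> /fp_classP /(qword_fp_eq 0).
(* The two products have real part 1 and last coordinates 4 and -4, which no positive factors
   reconcile. *)
case=> m [n [m0 n0]]; rewrite /qscale /qmul /= => -[e0 _ _ e3]; lia.
Qed.

(** The abelianization modulo 2, with values in (Z/2)^3. *)
Definition parity (w : seq (Z2grp + Zgrp)) : bool * bool * bool :=
  foldr (fun l v => match l with
    | inl u => (odd `|(u.1 : int)| (+) v.1.1, odd `|(u.2 : int)| (+) v.1.2, v.2)
    | inr k => (v.1, odd `|(k : int)| (+) v.2)
    end) (false, false, false) w.

Definition add3 (u v : bool * bool * bool) :=
  (u.1.1 (+) v.1.1, u.1.2 (+) v.1.2, u.2 (+) v.2).

Lemma parity_cat u v : parity (u ++ v) = add3 (parity u) (parity v).
Proof.
elim: u => [|l u IHu]; first by case: (parity v) => -[? ?] ?.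
by rewrite /= -/(parity (u ++ v)) IHu /add3 /=; case: l => k; rewrite /= !addbA.
Qed.

Lemma odd_absD (m n : int) : odd `|(m + n)%R| = odd `|m| (+) odd `|n|.
Proof. lia. Qed.

Lemma parity_fp_eq u v : fp_eq u v -> parity u = parity v.
Proof.
elim=> {u v} //.
- by move=> u v w _ -> _ ->.
- by move=> u u' v v' _ e _ e'; rewrite !parity_cat e e'.
- move=> a a'; rewrite /= !addbF; congr (_, _, _); exact/esym/odd_absD.
- move=> k k'; rewrite /= !addbF; congr (_, _); exact/esym/odd_absD.
Qed.

(** The witness is the preimage of the span of two vectors of (Z/2)^3; it is proper since all three
    basis vectors are attained. *)
Lemma Z2_free_Z_not_two_generated x y :
  exists2 S : set Z2_free_Z, is_subgroup S & [/\ S x, S y & exists z, ~ S z].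
Proof.
pose th z := parity (fp_repr z).
have thM u v : th (u * v) = add3 (th u) (th v).
  by rewrite /th -parity_cat; apply/parity_fp_eq/fp_repr_class.
have thE (w : seq (Z2grp + Zgrp)) : th (fp_class w) = parity w.
  exact/parity_fp_eq/fp_repr_class.
have th1 : th 1 = (false, false, false) by exact: (thE [::]).
have thV u : th u^-1 = th u.
  have := thM u^-1 u; rewrite mulVg th1; case: (th _) (th _) => -[a b] c [[a' b'] c'].
  by case: a b c a' b' c' => -[] [] [] [] [].
pose S : set Z2_free_Z := [set z | [|| th z == (false, false, false), th z == th x,
  th z == th y | th z == add3 (th x) (th y)]].
exists S; first split.
- by rewrite /S /= th1 eqxx.
- move=> u v; rewrite /S /= thM.
  case: (th x) (th y) => -[x1 x2] x3 [[y1 y2] y3].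
  by case/or4P => /eqP -> /or4P [] /eqP ->; rewrite /add3 /= ?addbb ?addbF ?addFb //;
    case: x1 x2 x3 y1 y2 y3 => -[] [] [] [] [].
- by move=> u; rewrite /S /= thV.
split; [by rewrite /S /= eqxx orbT|by rewrite /S /= eqxx !orbT|].
apply: contrapT => nz.
have Sall z : S z by apply: contrapT => nSz; apply: nz; exists z.
have := Sall (@fp_class Z2grp Zgrp [:: inl ((1 : int)%R, (0 : int)%R)]).
have := Sall (@fp_class Z2grp Zgrp [:: inl ((0 : int)%R, (1 : int)%R)]).
have := Sall (@fp_class Z2grp Zgrp [:: inr (1 : int)%R]).
rewrite /S /= !thE; case: (th x) (th y) => -[x1 x2] x3 [[y1 y2] y3].
by case: x1 x2 x3 y1 y2 y3 {nz Sall} => -[] [] [] [] [].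
Qed.

End FreeProductCommutation.

(** * Cutting the manifold to an interval *)

Section IntervalExtension.
Variable R : realType.
Local Notation I := (unit_interval R).
Implicit Types f g : I -> I.

Definition interval_ext f (x : R) : R :=
  if insub x is Some p then val (f p : I) else x.

Lemma interval_extE f (p : I) : interval_ext f (val p) = val (f p).
Proof. by rewrite /interval_ext valK. Qed.

Lemma interval_ext_out f x : ~~ (0 <= x <= 1) -> interval_ext f x = x.
Proof. by move=> xout; rewrite /interval_ext insubN. Qed.

Lemma interval_point (x : R) : 0 <= x <= 1 -> exists p : I, x = val p.
Proof. by move=> xin; exists (exist _ x xin). Qed.

Lemma interval_ext_C1 f :
  @C1_pos R Defs.Interval f -> locally_C1_pos 0 1 (interval_ext f).
Proof.
move=> Cf x /interval_point[p xp]; have [F [lF CF F0]] := Cf x p xp.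
exists F, 0; split=> //; move/nbhs_normP: lF => [del /= d0 Hd].
exists del => // y yd /interval_point[q yq].
rewrite subr0 yq interval_extE; apply/esym; rewrite -yq.
by apply: (Hd y _ q yq); rewrite /= distrC.
Qed.

Lemma interval_ext_id x : interval_ext id x = x.
Proof.
have [/interval_point[p ->]|xout] := boolP (0 <= x <= 1).
  by rewrite interval_extE.
by rewrite interval_ext_out.
Qed.

Lemma interval_ext_comp f g x :
  interval_ext (f \o g) x = interval_ext f (interval_ext g x).
Proof.
have [/interval_point[p ->]|xout] := boolP (0 <= x <= 1).
  by rewrite !interval_extE.
by rewrite !interval_ext_out.
Qed.

(** The point sent to an end of the interval is that end: otherwise monotonicity would send the end
    itself outside [[0, 1]]. *)
Lemma interval_ext_ends (f : diff1p R Defs.Interval) x :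
  x <= 0 \/ 1 <= x -> interval_ext f x = x.
Proof.
have inc := locally_C1_increasing (interval_ext_C1 (diff_fun_C1 f)).
have ends (q : I) : interval_ext f (val (diff_inv f q : I)) = val q.
  by rewrite interval_extE diff_invK.
have ext01 (p : I) : 0 <= interval_ext f (val p) <= 1.
  by rewrite interval_extE; exact: (valP (f p : I)).
have z0 : 0 <= (0 : R) <= 1 by rewrite lexx ler01.
have z1 : 0 <= (1 : R) <= 1 by rewrite lexx ler01.
have [p0 e0] := interval_point z0; have [p1 e1] := interval_point z1.
have f0 : interval_ext f 0 = 0.
  have := ends p0; rewrite -e0; set y : I := diff_inv f p0 => fy.
  have /andP[y0 y1] := valP y; move: y0; rewrite le_eqVlt => /orP[/eqP e|y0].
    by rewrite {1}e.
  have := inc _ _ (lexx 0) y0 y1; rewrite fy.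
  by have := ext01 p0; rewrite -e0 => /andP[]; lra.
have f1 : interval_ext f 1 = 1.
  have := ends p1; rewrite -e1; set y : I := diff_inv f p1 => fy.
  have /andP[y0 y1] := valP y; move: y1; rewrite le_eqVlt => /orP[/eqP e|y1].
    by rewrite -{1}e.
  have := inc _ _ y0 y1 (lexx 1); rewrite fy.
  by have := ext01 p1; rewrite -e1 => /andP[]; lra.
case=> [|]; rewrite le_eqVlt => /orP[/eqP|h].
- by move=> ->.
- by apply: interval_ext_out; apply/negP => /andP[]; lra.
- by move=> <-.
- by apply: interval_ext_out; apply/negP => /andP[]; lra.
Qed.

End IntervalExtension.

(** * Circle maps cut open at a fixed point *)

Section CircleExtension.
Variable R : realType.
Local Open Scope quotient_scope.
Local Notation S1 := (circle R).
Implicit Types f g : S1 -> S1.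

Definition circle_pi (x : R) : S1 := \pi_(Quotient.quot (integers R)) x.

Lemma circle_piP x y : circle_pi x = circle_pi y <-> x - y \is a Num.int.
Proof.
rewrite -integersE Quotient.idealrBE.
by split=> [e|/eqP //]; apply/eqP.
Qed.

Lemma circle_pi_surj (q : S1) : exists x, circle_pi x = q.
Proof. by exists (repr q); exact: reprK. Qed.

Lemma int_lt1_eq (x y : R) : x - y \is a Num.int -> `|x - y| < 1 -> x = y.
Proof.
move=> xyZ xy1; apply/eqP; rewrite -subr_eq0; apply: contraTT xy1 => xy0.
by rewrite -leNgt norm_intr_ge1.
Qed.

Lemma circle_rep_exists (x0 : R) (q : S1) :
  exists x, x0 <= x < x0 + 1 /\ circle_pi x = q.
Proof.
have [y yq] := circle_pi_surj q.
exists (y - (Num.floor (y - x0))%:~R); split; last first.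
  rewrite -yq; apply/circle_piP.
  by rewrite addrAC subrr add0r rpredN intr_int.
have := floor_le (y - x0); have := floorD1_gt (y - x0); rewrite intrD.
by move=> ? ?; apply/andP; split; lra.
Qed.

Definition circle_rep (x0 : R) (q : S1) : R := sval (cid (circle_rep_exists x0 q)).

Lemma circle_rep_itv x0 q : x0 <= circle_rep x0 q < x0 + 1.
Proof. by rewrite /circle_rep; case: cid => x []. Qed.

Lemma circle_repK x0 q : circle_pi (circle_rep x0 q) = q.
Proof. by rewrite /circle_rep; case: cid => x []. Qed.

Lemma circle_pi_inj (x0 x y : R) : x0 < x < x0 + 1 -> x0 <= y <= x0 + 1 ->
  circle_pi x = circle_pi y -> x = y.
Proof.
move=> /andP[? ?] /andP[? ?] /circle_piP xyZ; apply: int_lt1_eq => //.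
by rewrite ltr_norml; apply/andP; split; lra.
Qed.

(** The interval is open because at [x0 + 1] the representative could fall back to [x0]. *)
Definition circle_ext (x0 : R) f (x : R) : R :=
  if x0 < x < x0 + 1 then circle_rep x0 (f (circle_pi x)) else x.

Lemma circle_ext_out x0 f x : x <= x0 \/ x0 + 1 <= x -> circle_ext x0 f x = x.
Proof.
rewrite /circle_ext => out; case: ifP => // /andP[? ?].
by case: out; lra.
Qed.

Section FixedBasePoint.
Variables (x0 : R) (f : S1 -> S1).
Hypotheses (f_inj : injective f) (f_base : f (circle_pi x0) = circle_pi x0).

Lemma circle_ext_itv x : x0 < x < x0 + 1 -> x0 < circle_ext x0 f x < x0 + 1.
Proof.
move=> xin; rewrite /circle_ext xin.
have /andP[r0 r1] := circle_rep_itv x0 (f (circle_pi x)).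
rewrite r1 andbT lt_neqAle r0 andbT; apply/eqP => e.
have := circle_repK x0 (f (circle_pi x)); rewrite -e -f_base => /f_inj /esym.
move=> /(circle_pi_inj xin) xx0; have : x = x0 by apply: xx0; apply/andP; split; lra.
by case/andP: xin; lra.
Qed.

Lemma circle_extE x : x0 <= x <= x0 + 1 ->
  circle_pi (circle_ext x0 f x) = f (circle_pi x).
Proof.
move=> /andP[l r]; rewrite /circle_ext; case: ifP => [_|]; first exact: circle_repK.
have shift : circle_pi (x0 + 1) = circle_pi x0.
  by apply/circle_piP; rewrite addrAC subrr add0r int_num1.
move: l; rewrite le_eqVlt => /orP[/eqP <- //|l]; rewrite l /= => /negbT.
rewrite -leNgt => r'; have -> : x = x0 + 1 by lra.
by rewrite shift.
Qed.

(** Near [x] the extension and [F y - c] differ by an integer, so they coincide once the difference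
    is known to be less than 1 in absolute value. *)
Lemma circle_ext_C1 : @C1_pos R Circle f ->
  locally_C1_pos x0 (x0 + 1) (circle_ext x0 f).
Proof.
move=> Cf x xin; have [F [lF CF F0]] := Cf x (circle_pi x) erefl.
pose c := F x - circle_ext x0 f x.
have cZ : c \is a Num.int.
  apply/circle_piP; rewrite circle_extE //.
  exact: (nbhs_singleton lF) _ erefl.
exists F, c; split=> //; move/nbhs_normP: lF => [d1 /= d10 lF].
have Fint y : `|y - x| < d1 -> x0 <= y <= x0 + 1 ->
    circle_ext x0 f y - (F y - c) \is a Num.int.
  move=> yd yin; have -> : circle_ext x0 f y - (F y - c) =
    - (F y - circle_ext x0 f y - c) by ring.
  rewrite rpredN rpredB //; apply/circle_piP; rewrite circle_extE //.
  by apply: (lF y _ _ erefl); rewrite /= distrC.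
have [d2 d20 incF] := C1_near_increasing CF F0.
pose X := circle_ext x0 f x.
have [bound [bound0 Hb]] : exists e, 0 < e /\ forall y,
    `|F y - F x| < e -> `|y - x| < Num.min d2 e -> x0 <= y <= x0 + 1 ->
    `|circle_ext x0 f y - (F y - c)| < 1.
  have FX y : F y - c = F y - F x + X by rewrite /c -/X; ring.
  have x2 : `|x - x| < d2 by rewrite subrr normr0.
  have [xi|xb] := boolP (x0 < x < x0 + 1).
    have /andP[X0 X1] := circle_ext_itv xi; have /andP[xi0 xi1] := xi.
    pose e := Num.min (Num.min (X - x0) (x0 + 1 - X)) (Num.min (x - x0) (x0 + 1 - x)).
    exists e; split; first by rewrite !lt_min !subr_gt0 X0 X1 xi0.
    move=> y; rewrite /e !lt_min => /andP[/andP[f1 f2] _].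
    move=> /andP[_ /andP[_ /andP[y1 y2]]] _.
    have yi : x0 < y < x0 + 1.
      by move: y1 y2; rewrite !ltr_norml => /andP[? ?] /andP[? ?]; apply/andP; split; lra.
    have /andP[Y0 Y1] := circle_ext_itv yi; rewrite FX.
    move: f1 f2; rewrite !ltr_norml => /andP[? ?] /andP[? ?].
    by apply/andP; split; rewrite -/X; lra.
  have Xx : X = x.
    rewrite /X circle_ext_out //; have /andP[l r] := xin.
    by move: xb; rewrite negb_and -!leNgt => /orP[]; [left|right].
  (* At an end, radius 1 keeps [y] away from the other end, and monotonicity of [F] puts [F y - c]
     on the same side of [X] as the extension. *)
  exists 1; split=> // y f1; rewrite lt_min => /andP[y2 y1] yin.
  have [yi|yb] := boolP (x0 < y < x0 + 1); last first.
    have -> : circle_ext x0 f y = y.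
      rewrite circle_ext_out //; have /andP[l r] := yin.
      by move: yb; rewrite negb_and -!leNgt => /orP[]; [left|right].
    have -> : y = x.
      move: y1; rewrite ltr_norml => /andP[? ?].
      by move: xb yb; rewrite !negb_and -!leNgt => /orP[] ? /orP[] ?;
        have /andP[? ?] := xin; have /andP[? ?] := yin; lra.
    by rewrite FX subrr add0r Xx subrr normr0.
  have /andP[Y0 Y1] := circle_ext_itv yi; rewrite FX Xx.
  have /andP[yi0 yi1] := yi; have /andP[? ?] := xin.
  move: f1; rewrite ltr_norml => /andP[? ?]; rewrite ltr_norml.
  move: xb; rewrite negb_and -!leNgt => /orP[] xb.
    have xy : x < y by lra.
    by have Fxy := incF _ _ x2 y2 xy; apply/andP; split; lra.
  have yx : y < x by lra.
  by have Fyx := incF _ _ y2 x2 yx; apply/andP; split; lra.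
have [d3 d30 contF] := C1_near_continuous CF bound0.
exists (Num.min (Num.min d1 d2) (Num.min bound d3)).
  by rewrite !lt_min d10 d20 bound0.
move=> y; rewrite !lt_min => /andP[/andP[y1 y2] /andP[y3 y4]] yin.
apply: int_lt1_eq; first exact: Fint.
by apply: Hb => //; [exact: contF|rewrite lt_min y2].
Qed.

End FixedBasePoint.

Lemma circle_ext_id x0 x : circle_ext x0 id x = x.
Proof.
rewrite /circle_ext; case: ifP => // xin.
have /andP[r0 r1] := circle_rep_itv x0 (circle_pi x).
apply/esym/(circle_pi_inj xin); last by rewrite circle_repK.
by rewrite r0 ltW.
Qed.

Lemma circle_ext_fix x0 f x : f (circle_pi x) = circle_pi x -> circle_ext x0 f x = x.
Proof. by move=> fx; rewrite -[RHS](circle_ext_id x0) /circle_ext fx. Qed.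

Lemma circle_ext_comp x0 f g x : injective g -> g (circle_pi x0) = circle_pi x0 ->
  circle_ext x0 (f \o g) x = circle_ext x0 f (circle_ext x0 g x).
Proof.
move=> ginj g0; have [xin|] := boolP (x0 < x < x0 + 1).
  have gin := circle_ext_itv ginj g0 xin.
  rewrite [RHS]/circle_ext gin circle_extE //; last first.
    by case/andP: xin => ? ?; rewrite !ltW.
  by rewrite /circle_ext xin.
by rewrite negb_and -!leNgt => /orP out; rewrite !circle_ext_out.
Qed.

Lemma circle_ext_faithful x0 f : f (circle_pi x0) = circle_pi x0 ->
  circle_ext x0 f =1 id -> f =1 id.
Proof.
move=> f0 fid q; rewrite -(circle_repK x0 q).
have /andP[r0 r1] := circle_rep_itv x0 q.
by rewrite -(circle_extE f0) ?fid // r0 ltW.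
Qed.

Lemma circle_moved_open f x : @C1_pos R Circle f ->
  f (circle_pi x) <> circle_pi x ->
  exists2 e, 0 < e & forall y, `|y - x| < e -> f (circle_pi y) <> circle_pi y.
Proof.
move=> Cf fx; have [F [lF CF _]] := Cf x (circle_pi x) erefl.
have Fx : circle_pi (F x) = f (circle_pi x) by exact: (nbhs_singleton lF) _ erefl.
move/nbhs_normP: lF => [d1 /= d10 lF].
pose n := (Num.floor (F x - x))%:~R : R; have := floor_le (F x - x).
rewrite le_eqVlt => /orP[/eqP e|n0].
  case: fx; rewrite -Fx; apply/circle_piP; rewrite -e; exact: intr_int.
have := floorD1_gt (F x - x); rewrite intrD -/n => n1; rewrite -/n in n0.
(* Half the distance from [F x - x] to the nearest integer: [y] and [F y] each move by less than
   [m], so [F y - y] stays strictly between [n] and [n + 1]. *)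
pose m := Num.min (F x - x - n) (n + 1 - (F x - x)) / 2.
have m0 : 0 < m by rewrite divr_gt0 // lt_min; apply/andP; split; lra.
have [d2 d20 contF] := C1_near_continuous CF m0.
exists (Num.min (Num.min d1 d2) m); first by rewrite !lt_min d10 d20.
move=> y; rewrite !lt_min => /andP[/andP[y1 y2] y3] fy.
have Fy : circle_pi (F y) = f (circle_pi y) by apply: (lF y _ _ erefl); rewrite /= distrC.
have FyZ : F y - y \is a Num.int by apply/circle_piP; rewrite Fy.
have mle1 : 2 * m <= F x - x - n by rewrite /m mulrC divfK // ge_min lexx.
have mle2 : 2 * m <= n + 1 - (F x - x) by rewrite /m mulrC divfK // ge_min lexx orbT.
have := contF y y2; move: y3; rewrite !ltr_norml => /andP[? ?] /andP[? ?].
have nZ : n \is a Num.int by exact: intr_int.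
have e : F y - y = n.
  apply: int_lt1_eq; first exact: rpredB.
  by rewrite ltr_norml; apply/andP; split; lra.
by clear fx fy Fx Fy; lra.
Qed.

(** Lifted to the line, the supports are nonempty disjoint open sets, so an interval joining them
    contains a point outside both. *)
Lemma circle_common_fix (a b : diff1p R Circle) :
  supp a `&` supp b = set0 -> a <> 1%g -> b <> 1%g ->
  exists x, a (circle_pi x) = circle_pi x /\ b (circle_pi x) = circle_pi x.
Proof.
move=> dis a1 b1.
have moved (f : diff1p R Circle) : f <> 1%g -> exists x, f (circle_pi x) <> circle_pi x.
  move=> f1; apply: contrapT => nf; apply: f1; apply: diff_ext => q.
  have [x <-] := circle_pi_surj q; apply: contrapT => fx; apply: nf.
  by exists x.
have opn (f : diff1p R Circle) := @circle_moved_open f ^~ (@diff_fun_C1 R Circle f).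
have ab z : a (circle_pi z) <> circle_pi z -> b (circle_pi z) <> circle_pi z -> False.
  move=> az bz; have : (supp a `&` supp b) (circle_pi z) by split.
  by rewrite dis.
have [x ax] := moved a a1; have [y By] := moved b b1.
have fin z : ~ a (circle_pi z) <> circle_pi z /\ ~ b (circle_pi z) <> circle_pi z ->
    a (circle_pi z) = circle_pi z /\ b (circle_pi z) = circle_pi z.
  by case=> /contrapT ? /contrapT ?.
have [xy|yx|e] := ltgtP x y; last by case: (ab _ ax); rewrite e.
  have [z _ /fin] := @separating_point R [set z | a (circle_pi z) <> circle_pi z]
    [set z | b (circle_pi z) <> circle_pi z] x y (opn a) (opn b) ab xy ax By.
  by exists z.
have [z _ [nb na]] := @separating_point R [set z | b (circle_pi z) <> circle_pi z]
  [set z | a (circle_pi z) <> circle_pi z] y x (opn b) (opn a)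
  (fun z h h' => ab z h' h) yx By ax.
by exists z; exact: fin.
Qed.

End CircleExtension.

(** * Generating triples of the free product *)

Section Generators.

Lemma multiplicative1 (G K : groupType) (phi : {multiplicative K -> G}) :
  phi 1%g = 1%g.
Proof. by apply: (mulgI (phi 1%g)); rewrite -gmulfM !mulg1. Qed.

Lemma multiplicativeV (G K : groupType) (phi : {multiplicative K -> G}) :
  {morph phi : x / x^-1%g}.
Proof.
move=> x; apply: (mulgI (phi x)).
by rewrite -gmulfM !mulgV multiplicative1.
Qed.

(** Generation of [K] is expressed through its subgroups: the image by [phi] of such an [S] contains
    [a], [b] and [t], hence the group they generate. *)
Lemma isog_generators (G K : groupType) (a b t : G) :
  subgroup_isog (generated [set a; b; t]) K ->
  exists (phi : {multiplicative K -> G}) (a' b' t' : K),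
    [/\ injective phi, [/\ phi a' = a, phi b' = b & phi t' = t] &
    forall S : set K, is_subgroup S -> S a' -> S b' -> S t' -> forall z, S z].
Proof.
case=> phi [phi_in phi_inj phi_surj].
have gen g : [set a; b; t] g -> exists g', phi g' = g.
  move=> abtg; have [|g' _ <-] := phi_surj g; last by exists g'.
  by move=> A [_]; apply.
have [|a' ea] := gen a; first by left; left.
have [|b' eb] := gen b; first by left; right.
have [|t' et] := gen t; first by right.
have inj : injective phi by move=> x y e; apply: phi_inj; rewrite ?inE.
exists phi, a', b', t'; split=> // S [S1 SM SV] Sa Sb St z.
suff [z' Sz /inj <- //] : (phi @` S) (phi z).
have : generated [set a; b; t] (phi z) by exact: phi_in.
apply; split; last by move=> g [[|]|] ->; [exists a'|exists b'|exists t'].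
split.
- by exists 1%g => //; exact: multiplicative1.
- by move=> _ _ [x Sx <-] [y Sy <-]; exists (x * y)%g; [exact: SM|exact: gmulfM].
- by move=> _ [x Sx <-]; exists x^-1%g; [exact: SV|exact: multiplicativeV].
Qed.

(** If [a] were 1, two elements would generate; if [a] commuted with [t], it would be central, and
    transitivity through [a] would make the group abelian. *)
Lemma Z2_free_Z_generators (a b t : Z2_free_Z) : commute a b ->
  (forall S : set Z2_free_Z, is_subgroup S -> S a -> S b -> S t -> forall z, S z) ->
  a <> 1%g /\ ~ commute a t.
Proof.
move=> cab gen; have a1 : a <> 1%g.
  move=> a1; have [S sS [Sb St [z nSz]]] := Z2_free_Z_not_two_generated b t.
  by apply: nSz; apply: gen => //; rewrite a1; case: sS.
split=> // ccat; have [x [y ncxy]] := Z2_free_Z_not_abelian; apply: ncxy.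
have call z : commute a z.
  apply: (gen [set z | commute a z]) => //=; split=> /=.
  - exact: commute1.
  - exact: commuteM.
  - exact: commuteV.
exact: Z2_free_Z_commute_trans a1 (call x) (call y).
Qed.

End Generators.

(** * Faithful actions by diffeomorphisms *)

Section Realizations.
Variable R : realType.

Lemma disjoint_supp_commute (X : one_manifold) (a b : diff1p R X) :
  supp a `&` supp b = set0 -> commute a b.
Proof.
move=> dis; have fixed p : a p = p \/ b p = p.
  apply: contrapT => /not_orP[ap bp].
  by have : (supp a `&` supp b) p by []; rewrite dis.
apply: diff_ext => p /=; case: (fixed p) => [ap|bp].
  by rewrite ap; case: (fixed (b p)) => // /(can_inj (@diff_funK R X b)) ->.
by rewrite bp; case: (fixed (a p)) => // /(can_inj (@diff_funK R X a)) ->.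
Qed.

Lemma interval_disjoint_commute
    (phi : {multiplicative Z2_free_Z -> diff1p R Defs.Interval}) a b t :
  injective phi -> supp (phi a) `&` supp (phi b) = set0 ->
  a <> 1%g -> b <> 1%g -> commute a t.
Proof.
move=> inj dis a1 b1.
pose act k := interval_ext (phi k).
have lact : line_action [set: Z2_free_Z] act.
  split=> //.
  - by move=> x; rewrite /act multiplicative1; exact: interval_ext_id.
  - by move=> g h _ _ x; rewrite /act gmulfM; exact: interval_ext_comp.
  - move=> g _; apply: (@extension_increasing _ 0 1) => //.
      exact: interval_ext_ends.
    exact/interval_ext_C1/diff_fun_C1.
apply: (@disjoint_supports_commute R _ setT act 0 1 lact) a1 b1 => //.
- by move=> g x _; exact: interval_ext_ends.
- move=> g _ gid; apply: inj; rewrite multiplicative1; apply: diff_ext => p.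
  by apply: val_inj; rewrite -interval_extE; exact: gid.
- move=> g _; apply: (@extension_right_tame _ 0 1) => //.
    exact: interval_ext_ends.
  exact/interval_ext_C1/diff_fun_C1.
- move=> g _; apply: (@extension_left_tame _ 0 1) => //.
    exact: interval_ext_ends.
  exact/interval_ext_C1/diff_fun_C1.
- exact: Z2_free_Z_commute_trans.
- exact: Z2_free_Z_conj_commute.
- move=> x; have [/interval_point[p ->]|xout] := boolP (0 <= x <= 1); last first.
    by left; exact: interval_ext_out.
  rewrite /act !interval_extE; apply: contrapT => /not_orP[ap bp].
  by have : (supp (phi a) `&` supp (phi b)) p by
    [split=> e; [apply: ap|apply: bp]; rewrite e]; rewrite dis.
Qed.

Lemma circle_disjoint_commute
    (phi : {multiplicative Z2_free_Z -> diff1p R Circle}) (x0 : R) a b t :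
  injective phi -> supp (phi a) `&` supp (phi b) = set0 ->
  let base k := phi k (circle_pi x0) = circle_pi x0 in
  base a -> base b -> base t -> a <> 1%g -> b <> 1%g -> commute a t.
Proof.
move=> inj dis base ba bb bt a1 b1.
pose act k := circle_ext x0 (phi k).
have phi_inj k : injective (phi k) by exact: can_inj (@diff_funK R Circle (phi k)).
have x01 : x0 < x0 + 1 by rewrite ltrDl.
have C1 k : base k -> locally_C1_pos x0 (x0 + 1) (act k).
  by move=> bk; apply: circle_ext_C1 => //; exact: diff_fun_C1.
have lact : line_action base act.
  split.
  - split.
    + by rewrite /base multiplicative1.
    + by move=> g h bg bh; rewrite /base gmulfM /= bh.
    + by move=> g bg; rewrite /base multiplicativeV /= -{1}bg diff_funK.
  - by move=> x; rewrite /act multiplicative1; exact: circle_ext_id.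
  - by move=> g h _ bh x; rewrite /act gmulfM; exact: circle_ext_comp.
  - move=> g bg; apply: (@extension_increasing _ x0 (x0 + 1)) => //; last exact: C1.
    exact: circle_ext_out.
apply: (@disjoint_supports_commute R _ base act x0 (x0 + 1) lact) a1 b1 => //.
- by move=> g x _; exact: circle_ext_out.
- move=> g bg gid; apply: inj; rewrite multiplicative1; apply: diff_ext.
  exact: circle_ext_faithful bg gid.
- move=> g bg; apply: (@extension_right_tame _ x0 (x0 + 1)) => //; last exact: C1.
  exact: circle_ext_out.
- move=> g bg; apply: (@extension_left_tame _ x0 (x0 + 1)) => //; last exact: C1.
  exact: circle_ext_out.
- exact: Z2_free_Z_commute_trans.
- exact: Z2_free_Z_conj_commute.
- move=> x; apply: contrapT => /not_orP[ax bx].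
  have : (supp (phi a) `&` supp (phi b)) (circle_pi x).
    by split=> e; [apply: ax|apply: bx]; exact: circle_ext_fix.
  by rewrite dis.
Qed.

End Realizations.

Theorem theorem1p2 (R : realType) (X : one_manifold) (a b t : diff1p R X) :
  supp a `&` supp b = set0 ->
  ~ subgroup_isog (generated [set a; b; t]) Z2_free_Z.
Proof.
move=> dis /isog_generators[phi [a' [b' [t' [inj [ea eb et] gen]]]]].
have cab : commute a' b'.
  by apply: inj; rewrite !gmulfM ea eb; exact: disjoint_supp_commute.
have [a1 ncat] := Z2_free_Z_generators cab gen.
have [b1 ncbt] : b' <> 1%g /\ ~ commute b' t'.
  apply: (@Z2_free_Z_generators b' a') => [|S sS Sb Sa]; first exact: commute_sym.
  exact: gen.
rewrite -ea -eb in dis; case: X a b t phi ea eb et inj dis => a b t phi ea eb et inj dis.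
  exact: ncat (interval_disjoint_commute t' inj dis a1 b1).
have phi1 k : k <> 1%g -> phi k <> 1%g.
  by move=> k1 e; apply: k1; apply: inj; rewrite multiplicative1.
have [x [ax bx]] := circle_common_fix dis (phi1 _ a1) (phi1 _ b1).
pose y := diff_inv (phi t') (circle_pi x).
have baseJ k : phi k y = y -> phi (t' * k / t')%g (circle_pi x) = circle_pi x.
  by move=> ky; rewrite !gmulfM multiplicativeV /= -/y ky diff_invK.
have [ay|By] : phi a' y = y \/ phi b' y = y.
  apply: contrapT => /not_orP[ay By].
  by have : (supp (phi a') `&` supp (phi b')) y by []; rewrite dis.
(* The conjugate of [a'] by [t'] fixes the cut point and takes the place of [t']; commuting with it
   implies commuting with [t']. *)
- apply: ncat; apply: Z2_free_Z_conj_commute.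
  exact: circle_disjoint_commute inj dis ax bx (baseJ _ ay) a1 b1.
- apply: ncbt; apply: Z2_free_Z_conj_commute.
  by apply: circle_disjoint_commute inj _ bx ax (baseJ _ By) b1 a1; rewrite setIC.
Qed.
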